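(* An acyclic category $\mathcal C$ is isomorphic to the face category of a polyhedral CW complex if and only if, for every object $x$ of $\mathcal C$, the slice category $\mathcal C/x$ is isomorphic to the face poset of a polytope.
   Context: An acyclic category is a small category in which the only invertible morphisms are endomorphisms and the only endomorphisms are identities. A poset is regarded as a category with exactly one morphism $x\to y$ when $x\le y$ and none otherwise. The slice category $\mathcal C/x$ has as objects the morphisms of $\mathcal C$ with target $x$; morphisms from $\phi:a\to x$ to $\psi:b\to x$ correspond to the $\zeta\in\operatorname{Mor}_{\mathcal C}(a,b)$ with $\psi\circ\zeta=\phi$. A polytope is the convex hull of a finite nonempty set of points in Euclidean space. Faces of a polytope $P$ are the nonempty subsets $\{x\in P\mid \ell(x)=c\}$ with $\ell$ a linear form and $\ell\ge c$ on $P$ (so $P$ is a face of itself, the empty set is not). The face poset of $P$ is the set of its (nonempty) faces ordered by inclusion. A polyhedral homeomorphism is a homeomorphism between polytopes mapping every face onto a face. A polyhedral CW complex is a Hausdorff space $K$ with continuous maps $\{\alpha:P_\alpha\to K\}_{\alpha\in I}$, each $P_\alpha$ a convex polytope, such that, with $F(\alpha)=\alpha(\operatorname{int}P_\alpha)$ ($\operatorname{int}$ = relative interior): (PC0) $\alpha|_{\operatorname{int}P_\alpha}$ is a homeomorphism onto its image for all $\alpha$; (PC1) $K$ is the disjoint union of the $F(\alpha)$; (PC2) $B\subseteq K$ is closed iff $B\cap\alpha(P_\alpha)$ is closed for every $\alpha\in I$; (PC3) for every $\alpha\in I$ and every face $F$ of $P_\alpha$ there are $\beta\in I$ and a polyhedral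 homeomorphism $\phi^F:P_\beta\to F$ with $\beta=\alpha\circ\phi^F$ (these are unique). The face category $\mathcal F(K)$ has object set $I$ and as morphisms all $\phi^F:P_\beta\to F$, where $F$ ranges over the faces of all $P_\alpha$, with source $\beta$ and target $\alpha$; composing $\phi^F:\alpha\to\beta$ with $\phi^G:\beta\to\gamma$ gives $\phi^{\phi^G(F)}:\alpha\to\gamma$. *)

(* Defs.v *)
From HB Require Import structures.
From mathcomp Require Import all_boot all_order all_algebra.
From mathcomp Require Import all_classical all_reals.
From mathcomp Require Import interval_inference topology normedtype convex.
From mathcomp Require Import ring lra.
Import Order.TTheory GRing.Theory Num.Theory.
Import numFieldNormedType.Exports.

Set Implicit Arguments.
Unset Strict Implicit.
Unset Printing Implicit Defensive.

Local Open Scope classical_set_scope.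
Local Open Scope ring_scope.

Record category := Category {
  object :> Type;
  hom : object -> object -> Type;
  ident : forall x, hom x x;
  compose : forall x y z, hom y z -> hom x y -> hom x z;
  compose_idl : forall x y (f : hom x y), compose (ident y) f = f;
  compose_idr : forall x y (f : hom x y), compose f (ident x) = f;
  composeA : forall x y z t (h : hom z t) (g : hom y z) (f : hom x y),
    compose h (compose g f) = compose (compose h g) f }.

Arguments ident {c} x.
Arguments compose {c x y z} _ _.

Definition invertible (C : category) (x y : C) (f : hom x y) : Prop :=
  exists g : hom y x, compose g f = ident x /\ compose f g = ident y.

Definition acyclic (C : category) : Prop :=
  (forall (x y : C) (f : hom x y), invertible f -> x = y) /\
  (forall (x : C) (f : hom x x), f = ident x).

Record functor (C D : category) := Functor {
  fobj :> C -> D;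
  fmap : forall x y, hom x y -> hom (fobj x) (fobj y);
  fmap_ident : forall x, fmap (ident x) = ident (fobj x);
  fmap_compose : forall x y z (g : hom y z) (f : hom x y),
    fmap (compose g f) = compose (fmap g) (fmap f) }.

Arguments fmap {C D} _ {x y} _.

Definition id_functor (C : category) : functor C C :=
  @Functor C C id (fun _ _ => id) (fun _ => erefl) (fun _ _ _ _ _ => erefl).

Section ComposeFunctors.
Variables (C D E : category) (G : functor D E) (F : functor C D).

Lemma comp_fmap_ident (x : C) : fmap G (fmap F (ident x)) = ident (G (F x)).
Proof. by rewrite !fmap_ident. Qed.

Lemma comp_fmap_compose (x y z : C) (g : hom y z) (f : hom x y) :
  fmap G (fmap F (compose g f)) =
  compose (fmap G (fmap F g)) (fmap G (fmap F f)).
Proof. by rewrite !fmap_compose. Qed.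

Definition comp_functor : functor C E :=
  @Functor C E (G \o F) (fun _ _ => fmap G \o fmap F)
    comp_fmap_ident comp_fmap_compose.

End ComposeFunctors.

(* Isomorphism, not mere equivalence: the equalities are between functors. *)
Definition isomorphic (C D : category) : Prop :=
  exists (F : functor C D) (G : functor D C),
    comp_functor G F = id_functor C /\ comp_functor F G = id_functor D.

Section SliceCategory.
Variables (C : category) (x : C).

Definition slice_object := {a : C & hom a x}.

Definition slice_hom (phi psi : slice_object) :=
  {zeta : hom (tag phi) (tag psi) | compose (tagged psi) zeta = tagged phi}.

Definition slice_ident (phi : slice_object) : slice_hom phi phi :=
  exist _ (ident (tag phi)) (compose_idr (tagged phi)).

Lemma slice_compose_subproof (phi psi chi : slice_object)
    (g : slice_hom psi chi) (f : slice_hom phi psi) :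
  compose (tagged chi) (compose (sval g) (sval f)) = tagged phi.
Proof. by rewrite composeA (svalP g) (svalP f). Qed.

Definition slice_compose (phi psi chi : slice_object)
    (g : slice_hom psi chi) (f : slice_hom phi psi) : slice_hom phi chi :=
  exist _ (compose (sval g) (sval f)) (slice_compose_subproof g f).

Definition slice_category : category.
Proof.
exists slice_object slice_hom slice_ident slice_compose.
- by move=> phi psi f; apply: eq_sig_hprop => //=; exact: compose_idl.
- by move=> phi psi f; apply: eq_sig_hprop => //=; exact: compose_idr.
- by move=> a b c d h g f; apply: eq_sig_hprop => //=; exact: composeA.
Defined.

End SliceCategory.

Definition poset_category (d : Order.disp_t) (T : porderType d) : category.
Proof.
exists T (fun x y : T => (x <= y)%O) (fun x => le_refl x)
  (fun x y z (yz : (y <= z)%O) (xy : (x <= y)%O) => le_trans xy yz).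
- by move=> x y f; exact: bool_irrelevance.
- by move=> x y f; exact: bool_irrelevance.
- by move=> x y z t h g f; exact: bool_irrelevance.
Defined.

Definition subset_incl (T : Type) (A B : set T) (AB : A `<=` B) : A -> B :=
  fun x => SigSub (mem_set (AB _ (set_mem (valP x)))).

Definition to_range (T U : Type) (f : T -> U) : T -> range f :=
  fun x => SigSub (mem_set (imageT f x)).

Definition homeomorphism (X Y : topologicalType) (f : X -> Y) : Prop :=
  continuous f /\
  exists g : Y -> X, [/\ continuous g, cancel f g & cancel g f].

Lemma continuous_val (X : topologicalType) (A : set X) :
  continuous (val : A -> X).
Proof. exact: initial_continuous. Qed.

Lemma continuous_to_subset (X Y : topologicalType) (A : set Y) (f : X -> A) :
  continuous (val \o f) -> continuous f.
Proof. exact: (@continuous_comp_initial A X Y (@set_val Y A) f). Qed.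

Section Polytopes.
Variables (R : realType) (n : nat).
Local Notation V := 'rV[R]_n.

Definition convex_hull (A : set V) : set V :=
  smallest (@convex_set R V) A.

Definition affine_set (A : set V) : Prop :=
  forall (x y : V) (t : R), A x -> A y -> A ((1 - t) *: x + t *: y).

Definition affine_hull (A : set V) : set V := smallest affine_set A.

(* The interior of A relative to its affine hull; the topology of 'rV[R]_n is
   the Euclidean one, although the library norm is the max norm. *)
Definition relint (A : set V) : set V :=
  [set x | A x /\ \forall y \near x, affine_hull A y -> A y].

(* A itself is a face (l = 0, c = 0) as soon as it is nonempty. *)
Definition is_face (A : set V) : set (set V) :=
  [set F | F !=set0 /\
     exists (l : {scalar V}) (c : R), (forall x, A x -> c <= l x) /\
       F = [set x | A x /\ l x = c]].

Definition face (A : set V) : Type := set_type (is_face A).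

(* Faces are ordered by inclusion: the order of set V is `<=`. *)
HB.instance Definition _ (A : set V) := SubType.on (face A).
HB.instance Definition _ (A : set V) := Choice.on (face A).
HB.instance Definition _ (A : set V) :=
  [SubChoice_isSubPOrder of face A by <: with set_display].

Lemma relint_sub (A : set V) : relint A `<=` A.
Proof. by move=> x []. Qed.

Lemma face_sub (A : set V) (F : face A) : val F `<=` A.
Proof. by have /set_mem[_ [l [c [_ ->]]]] := valP F => x []. Qed.

End Polytopes.

Section FaceOfFace.
Variables (R : realType) (n : nat).
Local Notation V := 'rV[R]_n.
Local Notation convV := (convex_lmodType V).

Lemma sub_convex_hull (A : set V) : A `<=` convex_hull A.
Proof. exact: sub_gen_smallest. Qed.

Lemma convex_convex_hull (A : set V) : @convex_set R V (convex_hull A).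
Proof.
move=> x y t /set_mem Ax /set_mem Ay; apply/mem_set => B [cB AB].
by apply/set_mem/cB; apply/mem_set; [exact: Ax|exact: Ay].
Qed.

Definition scalar_comb (N : R) (l m : {scalar V}) (x : V) : R :=
  N * l x + m x.

Lemma scalar_comb_linear N l m : scalar (scalar_comb N l m).
Proof. by move=> a u v; rewrite /scalar_comb !linearP /=; ring. Qed.

HB.instance Definition _ N l m :=
  GRing.isLinear.Build R V R *%R (scalar_comb N l m)
    (@scalar_comb_linear N l m).

Lemma convex_hull_face_trans (A : set V) (F G : set V) : finite_set A ->
  is_face (convex_hull A) G -> is_face G F -> is_face (convex_hull A) F.
Proof.
move=> /finite_seqP[s ->] [_ [l [c [lP ->]]]] [F0 [m [d [mP FE]]]].
split => //.
pose r v := (d - m v) / (l v - c).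
have [N [N0 Ns]] : exists N, 0 < N /\ forall v, v \in s -> r v < N.
  elim: s {lP mP FE} => [|v s [N [N0 Ns]]]; first by exists 1.
  exists (Num.max N (r v + 1)); split; first by rewrite lt_max N0.
  move=> w; rewrite inE lt_max => /predU1P[->|/Ns->//].
  by rewrite ltrDl ltr01 orbT.
pose l' : {scalar V} := scalar_comb N l m.
exists l', (N * c + d).
pose S : set V := [set x | N * c + d <= l' x /\ (l' x = N * c + d -> F x)].
have sS : [set` s] `<=` S.
  move=> v vs; have Av := sub_convex_hull vs.
  have := lP _ Av; rewrite le_eqVlt => /predU1P[lv|lv].
    have := mP v (conj Av (esym lv)) => mv.
    rewrite /S /= /scalar_comb -lv; split; first by rewrite lerD2l.
    by move=> /addrI mvd; rewrite FE.
  have := Ns v vs; rewrite /r ltr_pdivrMr ?subr_gt0// => Nv.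
  have lt_v : N * c + d < l' v.
    by rewrite /= /scalar_comb; clear -Nv; lra.
  by split; [exact: ltW|move=> e; move: lt_v; rewrite e ltxx].
have cS : @convex_set R V S.
  apply/convex_setW => x y /set_mem[x1 x2] /set_mem[y1 y2] k k0 k1.
  apply/mem_set.
  have onemk : 0 < (1 - k%:num) by rewrite subr_gt0.
  have ck (f : {scalar V}) : f (@conv R convV k x y) =
      k%:num * f x + (1 - k%:num) * f y.
    pose u : V := x; pose v : V := y.
    have -> : @conv R convV k x y = k%:num *: u + (1 - k%:num) *: v by [].
    by rewrite linearD !linearZ.
  have x0 : 0 <= k%:num * (l' x - (N * c + d)).
    by rewrite mulr_ge0 ?subr_ge0 // ltW.
  have y0 : 0 <= (1 - k%:num) * (l' y - (N * c + d)).
    by rewrite mulr_ge0 ?subr_ge0 // ltW.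
  split; rewrite ck; first by clear -x0 y0; lra.
  move=> e.
  have /eqP : k%:num * (l' x - (N * c + d)) = 0
    by clear -x0 y0 e; lra.
  rewrite mulf_eq0 gt_eqF//= subr_eq0 => /eqP /x2.
  have /eqP : (1 - k%:num) * (l' y - (N * c + d)) = 0
    by clear -x0 y0 e; lra.
  rewrite mulf_eq0 (gt_eqF onemk)/= subr_eq0 => /eqP /y2.
  rewrite FE => -[[Ay ly] my] [[Ax lx] mx]; split; first split.
  - apply/set_mem/(@convex_convex_hull [set` s]); exact/mem_set.
  - by rewrite ck lx ly; ring.
  - by rewrite ck mx my; ring.
have hS : convex_hull [set` s] `<=` S by apply: smallest_sub.
split; first by move=> x /hS[].
apply/seteqP; split => x.
  by rewrite FE => -[[Ax lx] mx]; split=> //; rewrite /= /scalar_comb lx mx.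
by case=> /hS[_]; apply.
Qed.

Lemma face_itself (A : set V) : A !=set0 -> is_face A A.
Proof.
move=> A0; split=> //; exists \0, 0; split=> //.
by apply/seteqP; split=> x; [split|case].
Qed.

Lemma face_restrict (A F G : set V) :
  is_face A F -> F `<=` G -> G `<=` A -> is_face G F.
Proof.
move=> [F0 [l [c [lP FE]]]] FG GA; split => //.
exists l, c; split; first by move=> x /GA /lP.
rewrite FE in FG *; apply/seteqP.
by split=> x /= => [[Ax lx]|[/GA]//]; split=> //; exact: FG.
Qed.

End FaceOfFace.

Record polytope (R : realType) := Polytope {
  ambient_dim : nat;
  points :> set 'rV[R]_ambient_dim;
  pointsP : exists A : set 'rV[R]_ambient_dim,
    [/\ finite_set A, A !=set0 & points = convex_hull A] }.

Arguments points {R} _ _.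
Arguments pointsP {R} _.

Lemma polytope_face_trans (R : realType) (P : polytope R)
    (F G : set 'rV[R]_(ambient_dim P)) :
  is_face P G -> is_face G F -> is_face P F.
Proof.
by have [A [fA _ ->]] := pointsP P; exact: convex_hull_face_trans.
Qed.

Lemma polytope_neq0 (R : realType) (P : polytope R) : points P !=set0.
Proof.
by have [A [_ [x Ax] ->]] := pointsP P; exists x; exact: sub_convex_hull.
Qed.

Definition whole_face (R : realType) (P : polytope R) : face P :=
  SigSub (mem_set (face_itself (polytope_neq0 P))).

Definition polyhedral_homeomorphism (R : realType) (m n : nat)
    (A : set 'rV[R]_m) (B : set 'rV[R]_n) (f : A -> B) : Prop :=
  homeomorphism f /\
  forall F, is_face A F -> is_face B [set val (f x) | x in val @^-1` F].

Definition on_relint (R : realType) (P : polytope R) (T : Type) (f : P -> T) :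
    relint P -> T :=
  f \o subset_incl (@relint_sub _ _ P).

Definition on_face (R : realType) (P : polytope R) (T : Type) (f : P -> T)
    (F : face P) : val F -> T :=
  f \o subset_incl (@face_sub _ _ _ F).

Arguments on_face {R P T} f F _.

(* The cells index the characteristic maps; attach_face does not require b and
   phi to be unique, since this follows from the other fields. *)
Record polyhedral_complex (R : realType) := PolyhedralComplex {
  space : topologicalType;
  cell : Type;
  cell_polytope : cell -> polytope R;
  attach : forall a, cell_polytope a -> space;
  open_cell a : set space := range (on_relint (@attach a));
  space_hausdorff : hausdorff_space space;
  attach_continuous : forall a, continuous (@attach a);
  attach_relint_homeo :
    forall a, homeomorphism (to_range (on_relint (@attach a)));
  open_cells_disjoint : trivIset setT open_cell;
  open_cells_cover : \bigcup_a open_cell a = setT;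
  closed_cellwise : forall B : set space,
    closed B <-> forall a, closed (B `&` range (@attach a));
  attach_face : forall a (F : face (cell_polytope a)),
    exists b (phi : cell_polytope b -> val F),
      polyhedral_homeomorphism phi /\
      @attach b = on_face (@attach a) F \o phi }.

Arguments attach {R} p a _.

Section FaceCategory.
Variables (R : realType) (K : polyhedral_complex R).
Local Notation P := (@cell_polytope R K).

(* fh_face is determined by fh_map (fh_faceE), so two morphisms are equal as
   soon as they agree as maps to P a (face_hom_eq). *)
Record face_hom (b a : cell K) := FaceHom {
  fh_face : face (P a);
  fh_map : P b -> val fh_face;
  fh_homeo : polyhedral_homeomorphism fh_map;
  fh_attach : attach K b = on_face (attach K a) fh_face \o fh_map }.

Definition fh_fun (b a : cell K) (f : face_hom b a) : P b -> P a :=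
  subset_incl (@face_sub _ _ _ (fh_face f)) \o @fh_map _ _ f.

Lemma fh_faceE (b a : cell K) (f : face_hom b a) :
  val (fh_face f) = range (val \o fh_fun f).
Proof.
have [[_ [g [_ _ gK]]] _] := fh_homeo f; apply/seteqP; split=> x.
  by move=> /mem_set Fx; exists (g (SigSub Fx)); rewrite //= gK.
by case=> y _ <-; exact: (set_mem (valP (fh_map f y))).
Qed.

Lemma face_hom_eq (b a : cell K) (f g : face_hom b a) :
  (forall x, val (fh_fun f x) = val (fh_fun g x)) -> f = g.
Proof.
move=> fg; have: fh_face f = fh_face g.
  apply: val_inj; rewrite !fh_faceE.
  by rewrite (_ : val \o fh_fun f = val \o fh_fun g) //; exact/funext.
case: f g fg => [F p hp ap] [G q hq aq] pq /= FG.
move: q hq aq pq; case: _ / FG => q hq aq pq.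
have qp : p = q by apply/funext => x; apply: val_inj; exact: pq.
move: hq aq {pq}; case: _ / qp => hq aq.
by rewrite (Prop_irrelevance hp hq) (Prop_irrelevance ap aq).
Qed.

Definition fh_ident_map (a : cell K) : P a -> val (whole_face (P a)) := id.

Lemma fh_ident_homeo a : polyhedral_homeomorphism (@fh_ident_map a).
Proof.
split.
  split; first by move=> x; exact: cvg_id.
  by exists id; split => // x; exact: cvg_id.
move=> F FP; rewrite [X in is_face _ X](_ : _ = F) //.
apply/seteqP; split=> x; first by case=> y /= Fy <-.
move=> Fx; have Px : x \in points (P a).
  exact/mem_set/(@face_sub _ _ _ (SigSub (mem_set FP))).
by exists (SigSub Px).
Qed.

Lemma fh_ident_attach a :
  attach K a = on_face (attach K a) (whole_face (P a)) \o @fh_ident_map a.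
Proof. by apply/funext => x; congr attach; exact: val_inj. Qed.

Definition fh_ident (a : cell K) : face_hom a a :=
  FaceHom (@fh_ident_homeo a) (@fh_ident_attach a).

Section Compose.
Variables (a b c : cell K) (g : face_hom b c) (f : face_hom a b).

(* With g = phi^G and f = phi^F, this is the face phi^G(F) of P c. *)
Definition fh_image : set 'rV[R]_(ambient_dim (P c)) :=
  [set val (fh_map g y) | y in val @^-1` val (fh_face f)].

Lemma fh_image_sub : fh_image `<=` val (fh_face g).
Proof. by move=> _ [y _ <-]; exact: (set_mem (valP (fh_map g y))). Qed.

Lemma fh_image_face : is_face (P c) fh_image.
Proof.
apply: (polytope_face_trans (set_mem (valP (fh_face g)))).
by apply: (fh_homeo g).2; exact: (set_mem (valP (fh_face f))).
Qed.

Definition fh_compose_face : face (P c) := SigSub (mem_set fh_image_face).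

Lemma fh_compose_subproof x : val (fh_fun g (fh_fun f x)) \in fh_image.
Proof.
apply/mem_set; exists (fh_fun f x) => //.
exact: (set_mem (valP (fh_map f x))).
Qed.

Definition fh_compose_map (x : P a) : val fh_compose_face :=
  SigSub (fh_compose_subproof x).

Lemma fh_compose_homeo : polyhedral_homeomorphism fh_compose_map.
Proof.
have [[cf [f' [cf' fK f'K]]] ff] := fh_homeo f.
have [[cg [g' [cg' gK g'K]]] gf] := fh_homeo g.
split; last first.
  move=> F /ff fF.
  have fF' : is_face (P b) [set val (fh_map f x) | x in val @^-1` F].
    exact: (polytope_face_trans (set_mem (valP (fh_face f)))).
  have := gf _ fF'; set D := (X in is_face _ X) => gF.
  rewrite [X in is_face _ X](_ : _ = D).
    apply: (face_restrict (polytope_face_trans (set_mem (valP (fh_face g))) gF)).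
      move=> _ [y [x Fx xy] <-]; exists y => //=.
      by rewrite -xy; exact: (set_mem (valP (fh_map f x))).
    exact: (@face_sub _ _ _ fh_compose_face).
  apply/seteqP; split=> z.
    by case=> x Fx <-; exists (fh_fun f x) => //; exists x.
  case=> y [x Fx xy] <-; exists x => //=.
  by congr (val (fh_map g _)); exact: val_inj.
have cF : continuous (fh_fun f).
  apply: continuous_to_subset => x.
  exact: (continuous_comp (cf x) (@continuous_val _ _ _)).
split.
  apply: continuous_to_subset => x.
  apply: (@continuous_comp _ _ _ (fh_fun f) (val \o fh_map g)); first exact: cF.
  exact: (continuous_comp (cg _) (@continuous_val _ _ _)).
pose toG : fh_image -> val (fh_face g) := subset_incl fh_image_sub.
have hF (z : fh_image) : val (g' (toG z)) \in val (fh_face f).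
  have [y Fy yz] := set_mem (valP z).
  rewrite (_ : toG z = fh_map g y) ?gK; first exact/mem_set.
  exact: val_inj.
pose toF (z : fh_image) : val (fh_face f) := SigSub (hF z).
have cG : continuous toG by apply: continuous_to_subset; exact: continuous_val.
exists (f' \o toF); split.
- have cT : continuous toF.
    apply: continuous_to_subset => z.
    apply: (@continuous_comp _ _ _ (g' \o toG) val); last exact: continuous_val.
    exact: (continuous_comp (cG z) (cg' _)).
  by move=> z; exact: (continuous_comp (cT z) (cf' _)).
- move=> x /=; rewrite -[RHS]fK; congr f'; apply: val_inj => /=.
  rewrite (_ : toG _ = fh_map g (fh_fun f x)) ?gK //.
  exact: val_inj.
- move=> z; apply: val_inj => /=.
  rewrite (_ : fh_fun f _ = g' (toG z)) ?g'K //.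
  by apply: val_inj; rewrite /= f'K.
Qed.

Lemma fh_compose_attach :
  attach K a = on_face (attach K c) fh_compose_face \o fh_compose_map.
Proof.
rewrite (fh_attach f); apply/funext => x /=.
rewrite /on_face /= (fh_attach g) /=; congr attach; exact: val_inj.
Qed.

Definition fh_compose : face_hom a c :=
  FaceHom fh_compose_homeo fh_compose_attach.

End Compose.

Definition face_category : category.
Proof.
exists (cell K) face_hom fh_ident fh_compose.
- by move=> a b f; apply: face_hom_eq => x.
- move=> a b f; apply: face_hom_eq => x /=.
  by congr (val (fh_map f _)); exact: val_inj.
- move=> a b c d h g f; apply: face_hom_eq => x /=.
  by congr (val (fh_map h _)); exact: val_inj.
Defined.

End FaceCategory.

(* Main.v *)
From HB Require Import structures.
Require Import Defs.
From mathcomp Require Import all_boot all_order all_algebra.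
From mathcomp Require Import all_classical all_reals.
From mathcomp Require Import interval_inference topology normedtype.
From mathcomp Require Import convex derive.
From mathcomp Require Import ring lra.
(* The morphisms hom of a category prevail over those of vector spaces. *)
Import Defs.
Import Order.TTheory GRing.Theory Num.Theory.
Import numFieldNormedType.Exports.

(** In a polyhedral complex, a point of the polytope of a cell a lies in the
    relative interior of exactly one face, and a polyhedral homeomorphism
    reflects relative interiors (polyhedral_homeo_relint).  So the image of a
    point in the complex tells which cell parametrizes the face that carries it,
    and comparing one point of a relative interior is enough to identify cells.
    In this way a morphism to a is determined by its face (face_hom_same_face,
    face_hom_uniq), and it factors through every morphism to a with a larger
    face (face_hom_factor): the slice over a is the poset of faces.

    Conversely, let the slice over each object x be the poset of faces of a
    polytope P x.  Composition with h : b -> x embeds the faces of P b onto the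
    faces of P x below the face of h.  Barycentric subdivision turns this
    combinatorial embedding into a map.  Choose a point in the relative interior
    of every face; each point of a polytope is a convex combination of the chosen
    points of a chain of faces, in a unique way and with weights that depend
    continuously on it (chain_point_exists, chain_weights_uniq,
    bary_continuous_face).  Carrying the weights from each face to its image
    gives a polyhedral homeomorphism of P b onto the face of h (transport_homeo).
    These maps compose as the morphisms do, and the complex is the union of the
    polytopes glued along them.

    No quotient is formed.  A point y of P c is sent to the function that
    assigns to f : b -> a the sum, over g : a -> c, of the product of the weights
    of y at the faces of g and of g composed with f.  The gluing maps preserve
    this function (chain_weight_push), it tells the cells apart
    (chain_weight_cell), and on the relative interior it determines y by an
    explicit continuous formula (reconstructK).  Its values are continuous
    functions separating the points of the complex, which is therefore Hausdorff,
    infinite or not.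

    The geometry rests on one fact, that a point of a polytope outside the
    relative interior lies on a proper face (relint_or_proper_face); it is
    obtained from the alternative of Stiemke, that is, from the lemma of
    Farkas. *)

Set Implicit Arguments.
Unset Strict Implicit.
Unset Printing Implicit Defensive.

Local Open Scope classical_set_scope.
Local Open Scope ring_scope.

(** * Theorems of the alternative *)

Section Farkas.
Variable R : realFieldType.

(** Induction on the number of rows.  If the form u found for all rows but the
    first, w, is negative on w, then everything is projected along w to the
    kernel of u, where there is one row less. *)
Lemma farkas k n (W : 'M[R]_(k, n)) (b : 'rV[R]_n) :
  (exists t : 'rV[R]_k, (forall i, 0 <= t 0 i) /\ t *m W = b) \/
  (exists u : 'cV[R]_n, (forall i, 0 <= (W *m u) i 0) /\ (b *m u) 0 0 < 0).
Proof.
elim: k W b => [|k IH] W b.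
  have [->|b0] := eqVneq b 0.
    by left; exists 0; split=> [[]//|]; rewrite mul0mx.
  right; exists (- b^T); split=> [[]//|].
  rewrite mulmxN mxE oppr_lt0 mxE.
  have [i bi] : exists i, b 0 i != 0.
    apply/existsP; apply: contraR b0; rewrite negb_exists => /forallP b0.
    by apply/eqP/rowP => i; rewrite mxE; apply/eqP; move: (b0 i); rewrite negbK.
  rewrite (bigD1 i)//= ltr_wpDr//.
    by apply: sumr_ge0 => j _; rewrite !mxE -expr2 sqr_ge0.
  by rewrite mxE -expr2 lt_def sqr_ge0 sqrf_eq0 bi.
rewrite -[W](@vsubmxK _ 1 k).
set w : 'rV_n := usubmx _; set W' : 'M_(k, n) := dsubmx _.
case: (IH W' b) => [[t [t0 tb]]|[u [u0 bu]]].
  left; exists (row_mx (0 : 'rV_1) t); rewrite (@mul_row_col _ 1 1) mul0mx add0r.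
  split=> // i; have [j ->|j ->] := @split_ordP 1 k i.
    by rewrite (@row_mxEl _ 1 1) mxE.
  by rewrite (@row_mxEr _ 1 1).
have [wu|wu] := leP 0 ((w *m u) 0 0).
  right; exists u; split=> // i; rewrite (@mul_col_mx _ 1 k).
  have [j ->|j ->] := @split_ordP 1 k i.
    by rewrite (@col_mxEu _ 1 k) ord1.
  by rewrite (@col_mxEd _ 1 k).
pose p := - (w *m u) 0 0; have p0 : 0 < p by rewrite oppr_gt0.
case: (IH (p *: W' + (W' *m u) *m w) (p *: b + (b *m u) *m w)).
  move=> [t [t0 tb]]; left.
  pose c := ((t *m (W' *m u)) 0 0 - (b *m u) 0 0) / p.
  exists (row_mx (c%:M : 'M_1) t).
  rewrite (@mul_row_col _ 1 1); split.
    move=> i; have [j ->|j ->] := @split_ordP 1 k i.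
      rewrite (@row_mxEl _ 1 1) ord1 mxE eqxx mulr1n divr_ge0 ?ltW//.
      rewrite subr_gt0 (lt_le_trans bu)// mxE sumr_ge0// => l _.
      by rewrite mulr_ge0.
    by rewrite (@row_mxEr _ 1 1).
  apply: (scalerI (lt0r_neq0 p0)).
  have -> : p *: b = p *: (t *m W') + (t *m (W' *m u) - b *m u) *m w.
    rewrite mulmxBl -mulmxA scalemxAr addrA -mulmxDr tb.
    by rewrite addrK.
  rewrite addrC scalerDr; congr (_ + _).
  rewrite mul_scalar_mx scalerA mulrC divfK ?lt0r_neq0//.
  rewrite [X in _ = X *m _](_ : _ = (c * p)%:M).
    by rewrite mul_scalar_mx /c divfK ?lt0r_neq0.
  apply/matrixP=> i j; rewrite !ord1 [RHS]mxE mulr1n /c divfK ?lt0r_neq0//.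
  by rewrite mxE; congr (_ + _); rewrite mxE.
move=> [u' [u0' bu']]; right.
exists (p *: u' + (w *m u') 0 0 *: u).
have E (m : nat) (M : 'M[R]_(m, n)) i :
    (M *m (p *: u' + (w *m u') 0 0 *: u)) i 0 =
    ((p *: M + (M *m u) *m w) *m u') i 0.
  rewrite mulmxDr mulmxDl -!scalemxAr -scalemxAl mxE [RHS]mxE; congr (_ + _).
  have -> : M *m u *m w *m u' = (w *m u') 0 0 *: (M *m u) => //.
  by rewrite -mulmxA {1}[w *m u']mx11_scalar mul_mx_scalar.
split=> [i|]; last by rewrite E.
rewrite (@mul_col_mx _ 1 k); have [j ->|j ->] := @split_ordP 1 k i.
  rewrite (@col_mxEu _ 1 k) ord1 mulmxDr -!scalemxAr mxE [X in X + _]mxE.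
  by rewrite [X in _ + X]mxE /p mulNr mulrC addNr.
by rewrite (@col_mxEd _ 1 k) E.
Qed.

(** Apply the lemma of Farkas to the opposite of each row: either one of the
    separating forms is positive on its row, or the sum of all the relations has
    positive coefficients. *)
Lemma stiemke k n (W : 'M[R]_(k, n)) :
  (exists t : 'rV[R]_k, (forall i, 0 < t 0 i) /\ t *m W = 0) \/
  (exists u : 'cV[R]_n, (forall i, 0 <= (W *m u) i 0) /\ W *m u != 0).
Proof.
have H i : (exists t : 'rV[R]_k, [/\ forall i, 0 <= t 0 i, 0 < t 0 i & t *m W = 0]) \/
  (exists u : 'cV[R]_n, (forall i, 0 <= (W *m u) i 0) /\ W *m u != 0).
  case: (farkas W (- row i W)) => [[t [t0 tW]]|[u [u0 uW]]].
    left; exists (t + delta_mx 0 i); split.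
    - by move=> j; rewrite !mxE addr_ge0// ler0n.
    - by rewrite !mxE !eqxx ltr_wpDl// ltr01.
    - by rewrite mulmxDl tW -rowE addNr.
  right; exists u; split=> //; apply/eqP => Wu.
  by move: uW; rewrite mulNmx -row_mul Wu row0 !mxE oppr0 ltxx.
have [//|nu] := pselect (exists u : 'cV[R]_n,
  (forall i, 0 <= (W *m u) i 0) /\ W *m u != 0); first by right.
left.
have {nu}H i : exists t : 'rV[R]_k,
  [/\ forall i, 0 <= t 0 i, 0 < t 0 i & t *m W = 0] by case: (H i).
pose T i := sval (cid (H i)).
exists (\sum_i T i); split.
  move=> i; rewrite summxE (bigD1 i)//= ltr_wpDr//.
    by apply: sumr_ge0 => j _; rewrite /T; case: cid => t [].
  by rewrite /T; case: cid => t [].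
rewrite mulmx_suml big1// => i _; rewrite /T; case: cid => t [] //.
Qed.

End Farkas.

(** * Continuity and compactness *)

Section Topology.
Variable R : realType.

Lemma nbhs_forall (X : topologicalType) (I : finType) (x : X)
    (A : I -> set X) :
  (forall i, nbhs x (A i)) -> nbhs x [set y | forall i, A i y].
Proof. by move=> xA; apply: filter_forall. Qed.

Lemma continuous_mx (X : topologicalType) m n (f : X -> 'M[R]_(m, n)) :
  (forall i j, continuous (fun x => f x i j)) -> continuous f.
Proof.
move=> cf x U [P Pf PU].
have : \forall y \near x, forall i j, P i j (f y i j).
  by apply: filter_forall => i; apply: filter_forall => j; exact: cf (Pf i j).
by apply: filterS => y; exact: PU.
Qed.

Lemma continuous_sum (X : topologicalType) (V : normedModType R) I (r : seq I)
    (F : I -> X -> V) :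
  (forall i, continuous (F i)) -> continuous (fun x => \sum_(i <- r) F i x).
Proof. by move=> cF; apply: continuous_big => //; exact: add_continuous. Qed.

Lemma continuous_sumr (X : topologicalType) I (r : seq I) (F : I -> X -> R) :
  (forall i, continuous (F i)) -> continuous (fun x => \sum_(i <- r) F i x).
Proof. exact: (@continuous_sum X R). Qed.

Lemma continuous_mulr (X : topologicalType) (f g : X -> R) :
  continuous f -> continuous g -> continuous (fun x => f x * g x).
Proof. by move=> cf cg x; apply: cvgM; [exact: cf|exact: cg]. Qed.

Lemma continuous_addv (X : topologicalType) (V : normedModType R)
    (f g : X -> V) :
  continuous f -> continuous g -> continuous (fun x => f x + g x).
Proof. by move=> cf cg x; apply: cvgD; [exact: cf|exact: cg]. Qed.

Lemma continuous_scaler (X : topologicalType) (V : normedModType R)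
    (f : X -> R) (g : X -> V) :
  continuous f -> continuous g -> continuous (fun x => f x *: g x).
Proof. by move=> cf cg x; apply: cvgZ; [exact: cf|exact: cg]. Qed.

Lemma mulmx_continuous m k n (V : 'M[R]_(k, n)) :
  continuous (fun t : 'M[R]_(m, k) => t *m V).
Proof.
apply: continuous_mx => i j.
rewrite (_ : (fun _ => _) = fun t : 'M[R]_(m, k) => \sum_l t i l * V l j).
  apply: continuous_sumr => l; apply: continuous_mulr.
    exact: coord_continuous.
  exact: cst_continuous.
by apply/funext => t; rewrite mxE.
Qed.

Lemma closed_preimage (X Y : topologicalType) (f : X -> Y) (A : set Y) :
  continuous f -> closed A -> closed (f @^-1` A).
Proof. by move=> /continuous_closedP; exact. Qed.

Lemma compact_setT_val (X : topologicalType) (A : set X) :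
  compact A -> compact [set: A].
Proof.
move=> cA F FF _.
have FA : ((val : A -> X) @ F) A.
  by apply: (@filterS _ F _ setT) => [y _|]; [exact: set_mem (valP y)|exact: filterT].
have [x [Ax Fx]] := cA ((val : A -> X) @ F) _ FA.
exists (SigSub (mem_set Ax)); split=> // U W FU [_ [[W' oW' <-] W'x] sW].
have FU' : ((val : A -> X) @ F) (val @` U).
  by apply: (@filterS _ F _ U) => // y Uy; exists y.
have [_ [[y Uy <-] W'y]] := Fx _ _ FU' (open_nbhs_nbhs (conj oW' W'x)).
by exists y; split=> //; exact: sW.
Qed.

Definition simplex k : set 'rV[R]_k :=
  [set t | (forall i, 0 <= t 0 i) /\ \sum_i t 0 i = 1].

Lemma simplex_le1 k (t : 'rV[R]_k) i : simplex t -> t 0 i <= 1.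
Proof.
by move=> [t0 t1]; rewrite -t1 (bigD1 i)//= lerDl sumr_ge0.
Qed.

Lemma simplex_compact k : compact (@simplex k).
Proof.
pose cube := [set v : 'rV[R]_k | forall i, `[0, 1]%classic (v ord0 i)].
have cc : compact cube.
  by apply: (@rV_compact R k (fun=> `[0, 1]%classic)) => i; exact: segment_compact.
apply: (subclosed_compact _ cc).
  rewrite (_ : @simplex k = (\bigcap_(i in setT) [set t | 0 <= t 0 i]) `&`
    [set t | \sum_i t 0 i = 1]).
    apply: closedI.
      apply: closed_bigI => i _.
      apply: (@closed_preimage _ _ (fun t : 'rV[R]_k => t 0 i) [set x | 0 <= x]).
        exact: coord_continuous.
      exact: closed_ge.
    apply: (@closed_preimage _ _ (fun t : 'rV[R]_k => \sum_i t 0 i) [set x | x = 1]).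
      by apply: continuous_sumr => i; exact: coord_continuous.
    exact: closed_eq.
  by apply/seteqP; split=> t [h1 h2]; split=> // i; [move=> _|]; exact: h1.
move=> t st i /=; rewrite in_itv/= (simplex_le1 _ st) andbT; exact: st.1.
Qed.

End Topology.

(** * Convex sets and relative interiors *)

Section Convexity.
Variables (R : realType) (n : nat).
Local Notation V := 'rV[R]_n.
Implicit Types (A B F : set V) (x y z : V).

Definition convex A := @convex_set R V A.

Lemma convexP A : convex A <-> forall x y (s : R),
  0 <= s -> s <= 1 -> A x -> A y -> A (s *: x + (1 - s) *: y).
Proof.
split=> [cA x y s s0 s1 Ax Ay|cA x y s /set_mem Ax /set_mem Ay].
  exact: set_mem (cA x y (Itv01 s0 s1) (mem_set Ax) (mem_set Ay)).
by apply/mem_set/cA.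
Qed.

Lemma convex_sum A (I : Type) (r : seq I) (t : I -> R) (v : I -> V) :
  convex A -> (forall i, 0 <= t i) -> (forall i, t i != 0 -> A (v i)) ->
  \sum_(i <- r) t i = 1 -> A (\sum_(i <- r) t i *: v i).
Proof.
move=> /convexP cA t0 tA t1.
suff H : 0 < \sum_(i <- r) t i ->
    A ((\sum_(i <- r) t i)^-1 *: \sum_(i <- r) t i *: v i).
  by move: H; rewrite t1 invr1 scale1r; apply.
elim: r {t1} => [|i r IH]; first by rewrite big_nil ltxx.
rewrite !big_cons; set T := \sum_(j <- r) t j in IH *.
set v' := \sum_(j <- r) _ in IH *.
have T0 : 0 <= T by exact: sumr_ge0.
have [->|ti0] := eqVneq (t i) 0; first by rewrite scale0r !add0r.
have ti : 0 < t i by rewrite lt_def ti0 t0.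
have [TE|Tn0] := eqVneq T 0.
  have -> : v' = 0.
    have t0' j : true -> 0 <= t j by [].
    rewrite /v'; move/eqP: TE; rewrite /T {IH T0 v' T}.
    elim: r => [|j r IH]; first by rewrite !big_nil.
    rewrite !big_cons paddr_eq0 ?sumr_ge0// => /andP[/eqP-> /IH->].
    by rewrite scale0r addr0.
  by rewrite TE !addr0 scalerA mulVf// scale1r => _; exact: tA.
have {}T0 : 0 < T by rewrite lt_def Tn0.
move=> _; have -> : (t i + T)^-1 *: (t i *: v i + v') =
    (t i / (t i + T)) *: v i + (1 - t i / (t i + T)) *: (T^-1 *: v').
  rewrite scalerDr !scalerA mulrC; congr (_ + _ *: _).
  by field; rewrite Tn0 gt_eqF ?addr_gt0.
apply: cA; [|  |exact: tA|exact: IH].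
  by rewrite divr_ge0 ?addr_ge0// ltW.
by rewrite ler_pdivrMr ?addr_gt0// mul1r lerDl ltW.
Qed.

Lemma affine_hull_sub A : A `<=` affine_hull A.
Proof. exact: sub_gen_smallest. Qed.

Lemma affine_hull_affine A : affine_set (affine_hull A).
Proof. by move=> x y t Ax Ay B AB; apply: AB.1; [exact: Ax AB|exact: Ay AB]. Qed.

(** An affine set is only assumed to contain the line through any two of its
    points; the translate is the midpoint of two points of such lines, one
    through x and y and one through x and z. *)
Lemma affine_hull_translate A x y z (t : R) :
  affine_hull A x -> affine_hull A y -> affine_hull A z ->
  affine_hull A (x + t *: (y - z)).
Proof.
move=> Ax Ay Az; have aA := @affine_hull_affine A.
have := aA _ _ 2^-1 (aA _ _ (2 * t) Ax Ay) (aA _ _ (- (2 * t)) Ax Az).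
by congr affine_hull; apply/rowP => i; rewrite !mxE; field.
Qed.

Lemma ray_cvg x (d : V) : (fun e : R => x + e *: d) @ (0 : R) --> x.
Proof.
have : (fun e : R => x + e *: d) @ (0 : R) --> x + 0 *: d.
  apply: cvgD; first exact: cvg_cst.
  by apply: cvgZ; [exact: cvg_id|exact: cvg_cst].
by rewrite scale0r addr0.
Qed.

(** The defining property of a relative interior point in the form in which it
    is used: it can be moved a little in any direction of the affine hull. *)
Lemma relint_extend A x y z : relint A x -> affine_hull A y ->
  affine_hull A z -> exists2 e : R, 0 < e & A (x + e *: (y - z)).
Proof.
move=> [Ax nA] Ay Az.
have : \forall e \near (0 : R), A (x + e *: (y - z)).
  have : \forall e \near (0 : R), affine_hull A (x + e *: (y - z)) ->
      A (x + e *: (y - z)) := @ray_cvg x (y - z) _ nA.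
  apply: filterS => e; apply.
  exact: affine_hull_translate (affine_hull_sub Ax) Ay Az.
move=> /nbhs_ballP[e /= e0 eA]; exists (e / 2); first by rewrite divr_gt0.
apply: eA; rewrite /ball/= sub0r normrN gtr0_norm ?divr_gt0//.
by rewrite ltr_pdivrMr// ltr_pMr// ltr1n.
Qed.

(** A linear form minimal at a relative interior point is constant on A, since
    the segment from any other point can be prolonged beyond it. *)
Lemma face_relint_sub A B F x : is_face B F -> A `<=` B -> relint A x -> F x ->
  A `<=` F.
Proof.
move=> [_ [l [c [lB ->]]]] AB rx [_ lx] y Ay; split; first exact: AB.
have Ax := rx.1.
have [e e0 Ae] := relint_extend rx (affine_hull_sub Ax) (affine_hull_sub Ay).
apply/eqP; rewrite eq_le lB ?andbT; last exact: AB.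
have := lB _ (AB _ Ae); rewrite linearD linearZ linearB/= lx lerDl pmulr_rge0//.
by rewrite subr_ge0.
Qed.

(** Near z = (1 - s) x + s r, each point of the affine hull is again on a segment
    from x to a point near r. *)
Lemma relint_segment A x r (s : R) : convex A -> A x -> relint A r ->
  0 < s -> s <= 1 -> relint A ((1 - s) *: x + s *: r).
Proof.
move=> /convexP cA Ax [Ar nr] s0 s1.
have sn0 : s != 0 by rewrite gt_eqF.
have Az : A ((1 - s) *: x + s *: r).
  by rewrite addrC; apply: cA => //; exact: ltW.
split=> //; set z : V := _ + _ in Az *.
pose g (y : V) : V := r + s^-1 *: (y - z).
have : g @ z --> r.
  have cg : continuous g.
    apply: continuous_addv; first exact: cst_continuous.
    apply: continuous_scaler; first exact: cst_continuous.
    by apply: continuous_addv; [move=> y; exact: cvg_id|exact: cst_continuous].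
  by have := cg z; rewrite /continuous_at {2}/g subrr scaler0 addr0.
move=> gz; have nz : \forall y \near z, affine_hull A (g y) -> A (g y) :=
  gz _ nr.
apply: filterS nz => y hy Hy.
have -> : y = s *: g y + (1 - s) *: x.
  by apply/rowP => i; rewrite /g /z !mxE; field.
apply: cA => //; first exact: ltW.
apply: hy; apply: affine_hull_translate => //; exact: affine_hull_sub.
Qed.

End Convexity.

(** * Convex hulls of finitely many points *)

Section VertexHull.
Variables (R : realType) (n : nat).
Local Notation V := 'rV[R]_n.
Implicit Types (A B F : set V) (x y z : V).

Definition hull k (M : 'M[R]_(k, n)) : set V := [set t *m M | t in @simplex R k].

Lemma hull_convex k (M : 'M[R]_(k, n)) : convex (hull M).
Proof.
apply/convexP => _ _ s s0 s1 [t [t0 t1] <-] [u [u0 u1] <-].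
exists (s *: t + (1 - s) *: u); last by rewrite mulmxDl -!scalemxAl.
split=> [i|]; first by rewrite !mxE addr_ge0// mulr_ge0// subr_ge0.
under eq_bigr do rewrite !mxE.
by rewrite big_split/= -!mulr_sumr t1 u1; ring.
Qed.

Lemma hull_row k (M : 'M[R]_(k, n)) i : hull M (row i M).
Proof.
exists (delta_mx 0 i); last by rewrite -rowE.
split=> [j|]; first by rewrite mxE ler0n.
rewrite (bigD1 i)//= mxE !eqxx big1 ?addr0// => j /negPf ji.
by rewrite mxE ji andbF.
Qed.

Lemma hull_sub_convex k (M : 'M[R]_(k, n)) (t : 'rV[R]_k) A : convex A ->
  simplex t -> (forall i, t 0 i != 0 -> A (row i M)) -> A (t *m M).
Proof.
move=> cA [t0 t1] tA; rewrite mulmx_sum_row.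
by apply: (convex_sum (t := fun i => t 0 i)).
Qed.

Lemma convex_hull_rows k (M : 'M[R]_(k, n)) :
  convex_hull (range (fun i => row i M)) = hull M.
Proof.
apply/seteqP; split=> x.
  apply; split; first exact: hull_convex.
  by move=> _ [i _ <-]; exact: hull_row.
move=> [t st <-] B [cB MB]; apply: (hull_sub_convex cB st) => i _.
by apply: MB; exists i.
Qed.

(** The property required of the underlying set of a polytope; it is inherited
    by faces, which are not polytopes but sets. *)
Definition polytopal A :=
  exists B : set V, [/\ finite_set B, B !=set0 & A = convex_hull B].

Lemma polytopal_hull A : polytopal A -> exists k (M : 'M[R]_(k, n)), A = hull M.
Proof.
move=> [B [/finite_seqP[s ->] _ ->]].
exists (size s), (\matrix_(i < size s) s`_i); rewrite -convex_hull_rows.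
congr convex_hull; apply/seteqP; split=> x /=.
  move=> /(nthP 0)[i si <-]; exists (Ordinal si) => //.
  by rewrite rowK.
by move=> [i _ <-]; rewrite rowK mem_nth.
Qed.

(** The matrix W has the rows of M seen from x.  A point y of the affine hull
    gives y - x in the row space of W, so y - x = s *m W with s depending
    linearly on y and zero at y = x.  Correcting t by s keeps the sum equal to 1,
    and keeps the coefficients positive for y near x. *)
Lemma relint_positive k (M : 'M[R]_(k, n)) (t : 'rV[R]_k) :
  (forall i, 0 < t 0 i) -> \sum_i t 0 i = 1 -> relint (hull M) (t *m M).
Proof.
move=> t0 t1; set x : V := t *m M.
have hx : hull M x by exists t => //; split=> // i; exact: ltW.
split=> //.
pose one : 'cV[R]_k := const_mx 1.
pose W := M - one *m x.
have Wrow i : row i W = row i M - x.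
  rewrite /W raddfB/= row_mul (_ : row i one = 1%:M) ?mul1mx//.
  by apply/matrixP => a b; rewrite !ord1 !mxE eqxx.
have sumE (s : 'rV[R]_k) : s *m one = (\sum_i s 0 i)%:M.
  apply/matrixP => a b; rewrite !ord1 !mxE eqxx mulr1n.
  by apply: eq_bigr => i _; rewrite mxE mulr1.
have hullW : affine_hull (hull M) `<=` [set y | (y - x <= W)%MS].
  apply: smallest_sub => [y z s /= yW zW|_ [u [_ u1] <-] /=].
    rewrite (_ : _ - x = (1 - s) *: (y - x) + s *: (z - x)).
      by apply: addmx_sub; exact: scalemx_sub.
    by apply/rowP => i; rewrite !mxE; ring.
  rewrite (_ : _ - x = u *m W); first exact: submxMl.
  by rewrite mulmxBr mulmxA sumE u1 mul1mx.
pose Q := pinvmx W *m (1%:M - one *m t).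
pose u y := t + (y - x) *m Q.
have cu : continuous u.
  apply: continuous_addv; first exact: cst_continuous.
  move=> y; apply: (@continuous_comp _ _ _ (fun y => y - x) (mulmx^~ Q)).
    apply: (@continuous_addv R _ _ id (cst (- x))) => //.
      by move=> z; exact: cvg_id.
    exact: cst_continuous.
  exact: mulmx_continuous.
have upos : \forall y \near x, forall i, 0 < u y 0 i.
  apply: nbhs_forall => i.
  have cui : continuous (fun y => u y 0 i).
    move=> y; apply: (@continuous_comp _ _ _ u (fun v => v 0 i)); first exact: cu.
    exact: coord_continuous.
  apply: (cui x [set a | 0 < a]); apply: open_nbhs_nbhs; split; first exact: open_gt.
  by rewrite /= /u subrr mul0mx addr0.
apply: filterS upos => y uy /hullW /= yW.
exists (u y); first split; first by move=> i; exact: ltW.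
  have : (u y *m one) 0 0 = 1.
    have Q1 : Q *m one = 0.
      rewrite /Q -[LHS]mulmxA (mulmxBl 1%:M) -(mulmxA one) sumE t1 mul1mx mulmx1.
      by rewrite subrr mulmx0.
    by rewrite /u mulmxDl sumE t1 -mulmxA Q1 mulmx0 addr0 mxE eqxx.
  by rewrite sumE mxE eqxx mulr1n.
have QM : Q *m M = pinvmx W *m W.
  by rewrite /Q -[LHS]mulmxA (mulmxBl 1%:M) mul1mx -(mulmxA one).
rewrite /u mulmxDl -/x -mulmxA QM mulmxA.
by rewrite mulmxKpV// addrC subrK.
Qed.

Definition col_form (u : 'cV[R]_n) (x : V) : R := (x *m u) 0 0.

Lemma col_form_linear u : scalar (col_form u).
Proof. by move=> a x y; rewrite /col_form mulmxDl -scalemxAl !mxE. Qed.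

HB.instance Definition _ u :=
  GRing.isLinear.Build R V R *%R (col_form u) (@col_form_linear u).

(** The alternative of Stiemke for the rows of M seen from x: a positive relation
    makes x a combination with positive coefficients, and a form that is
    nonnegative on these rows and not zero exposes a proper face through x. *)
Lemma relint_or_proper_face k (M : 'M[R]_(k, n)) x : hull M x ->
  relint (hull M) x \/
  exists F, [/\ is_face (hull M) F, F x & ~ hull M `<=` F].
Proof.
move=> hx; pose W := M - const_mx 1 *m x.
have Wrow i : row i W = row i M - x.
  rewrite /W raddfB/= row_mul (_ : row i _ = 1%:M) ?mul1mx//.
  by apply/matrixP => a b; rewrite !ord1 !mxE eqxx.
case: (stiemke W) => [[t [t0 tW]]|[u [u0 Wu]]].
  left; have c0 : 0 < \sum_i t 0 i.
    rewrite lt_def sumr_ge0 ?andbT => [|i _]; last exact: ltW.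
    apply/eqP => S0; have [r [_ r1] _] := hx.
    move: r1; rewrite big1 => [/esym/eqP|i _]; first by rewrite oner_eq0.
    have := t0 i; rewrite (@psumr_eq0P _ _ xpredT _ _ S0 i) ?ltxx// => j _.
    exact: ltW.
  set c := \sum_i _ in c0; have cn0 := lt0r_neq0 c0.
  have -> : x = (c^-1 *: t) *m M.
    apply: (scalerI cn0); rewrite -scalemxAl scalerA divff// scale1r.
    apply/eqP; rewrite eq_sym -subr_eq0; apply/eqP; rewrite -[RHS]tW mulmxBr mulmxA.
    congr (_ - _); rewrite -mul_scalar_mx; congr (_ *m _).
    apply/matrixP => a b; rewrite !ord1 !mxE eqxx mulr1n.
    by apply: eq_bigr => i _; rewrite mxE mulr1.
  apply: relint_positive => [i|]; first by rewrite mxE mulr_gt0// invr_gt0.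
  by under eq_bigr do rewrite mxE; rewrite -mulr_sumr mulVf.
right; pose l : {scalar V} := col_form u.
have lM i : l (row i M) = l x + (W *m u) i 0.
  rewrite -[row i M](subrK x) -Wrow linearD/= addrC; congr (_ + _).
  by rewrite /col_form -row_mul mxE.
exists [set y | hull M y /\ l y = l x]; split=> //.
  split; first by exists x.
  exists l, (l x); split=> // _ [t [t0 t1] <-].
  rewrite mulmx_sum_row linear_sum/=.
  rewrite -[leLHS]mul1r -t1 mulr_suml; apply: ler_sum => i _.
  by rewrite linearZ/= ler_wpM2l// [leRHS]lM lerDl.
move=> H; move/eqP: Wu; apply; apply/colP => i; rewrite [RHS]mxE.
have [_] := H _ (hull_row M i).
by rewrite lM => /(canRL (addKr _)) ->; rewrite addNr.
Qed.

Lemma face_convex A F : convex A -> is_face A F -> convex F.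
Proof.
move=> /convexP cA [_ [l [c [lA ->]]]]; apply/convexP.
move=> x y s s0 s1 [Ax lx] [Ay ly]; split; first exact: cA.
by rewrite linearD !linearZ/= lx ly; ring.
Qed.

(** In a convex combination that lies on the face, a row with a nonzero
    coefficient must itself be on the face. *)
Lemma face_hull_vertices k (M : 'M[R]_(k, n)) F : is_face (hull M) F ->
  F = convex_hull [set row i M | i in [set i | F (row i M)]].
Proof.
move=> fF; apply/seteqP; split=> x.
  have [_ [l [c [lM FE]]]] := fF; rewrite {1}FE => -[[t st <-] lt].
  apply: (hull_sub_convex _ st); first exact: convex_convex_hull.
  move=> i ti; apply: sub_convex_hull; exists i => //=; rewrite FE.
  split; first exact: hull_row.
  have [t0 t1] := st; apply/eqP; rewrite -subr_eq0; apply/eqP.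
  have S0 : \sum_i t 0 i * (l (row i M) - c) = 0.
    under eq_bigr do rewrite mulrBr.
    rewrite sumrB -mulr_suml t1 mul1r -lt mulmx_sum_row linear_sum/=.
    by apply/eqP; rewrite subr_eq0; apply/eqP/eq_bigr => j _; rewrite linearZ.
  have /eqP := S0; rewrite psumr_eq0.
    move=> /allP/(_ i); rewrite mem_index_enum => /(_ isT)/=.
    by rewrite mulf_eq0 (negPf ti)/= => /eqP.
  by move=> j _; rewrite mulr_ge0// subr_ge0 lM//; exact: hull_row.
apply; split; first exact: face_convex (@hull_convex _ _) fF.
by move=> _ [i Fi <-].
Qed.

Lemma relint_hull_neq0 k (M : 'M[R]_(k, n)) : hull M !=set0 ->
  relint (hull M) !=set0.
Proof.
case: k M => [M [_ [t [_ t1] _]]|k M _].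
  by move: t1; rewrite big_ord0 => /esym/eqP; rewrite oner_eq0.
exists (const_mx (k.+1%:R^-1) *m M); apply: relint_positive.
  by move=> i; rewrite mxE invr_gt0 ltr0n.
under eq_bigr do rewrite mxE.
by rewrite sumr_const card_ord -[LHS]mulr_natr mulVf// pnatr_eq0.
Qed.

Lemma hull_compact k (M : 'M[R]_(k, n)) : compact (hull M).
Proof.
apply: continuous_compact; last exact: simplex_compact.
exact/continuous_subspaceT/mulmx_continuous.
Qed.

Lemma polytopal_face A F : polytopal A -> is_face A F -> polytopal F.
Proof.
move=> /polytopal_hull[k [M ->]] fF.
have [x Fx] := fF.1.
have FE := face_hull_vertices fF; set S := [set row i M | i in _] in FE.
exists S; split=> //.
  by apply: finite_image; exact: finite_finset.
apply: contrapT => /set0P/negP; rewrite negbK => /eqP S0.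
have : convex_hull S x by rewrite -FE.
rewrite S0 => /(_ set0); apply; split=> // y z s; rewrite inE.
Qed.

Lemma polytopal_convex A : polytopal A -> convex A.
Proof. by move=> [B [_ _ ->]]; exact: convex_convex_hull. Qed.

Lemma polytopal_compact A : polytopal A -> compact A.
Proof. by move=> /polytopal_hull[k [M ->]]; exact: hull_compact. Qed.

Lemma polytopal_neq0 A : polytopal A -> A !=set0.
Proof. by move=> [B [_ [x Bx] ->]]; exists x; exact: sub_convex_hull. Qed.

Lemma polytopal_relint_neq0 A : polytopal A -> relint A !=set0.
Proof.
move=> pA; have := polytopal_neq0 pA; have [k [M ->]] := polytopal_hull pA.
exact: relint_hull_neq0.
Qed.

Lemma polytopal_relint_or_face A x : polytopal A -> A x ->
  relint A x \/ exists F, [/\ is_face A F, F x & ~ A `<=` F].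
Proof. by move=> /polytopal_hull[k [M ->]]; exact: relint_or_proper_face. Qed.

End VertexHull.

(** * The poset of faces of a polytope *)

Section FacePoset.
Variables (R : realType) (P : polytope R).
Local Notation V := 'rV[R]_(ambient_dim P).
Implicit Types (F G : face P) (x y z : V).

Lemma face_isface F : is_face P (val F).
Proof. exact: set_mem (valP F). Qed.

Lemma face_polytopal F : polytopal (val F).
Proof. exact: polytopal_face (pointsP P) (face_isface F). Qed.

Lemma face_is_convex F : convex (val F).
Proof. exact: polytopal_convex (face_polytopal F). Qed.

Definition mkface (A : set V) (fA : is_face P A) : face P :=
  SigSub (mem_set fA).

Let vertex_count := sval (cid (polytopal_hull (pointsP P))).
Let vertex : 'M[R]_(vertex_count, ambient_dim P) :=
  sval (cid (svalP (cid (polytopal_hull (pointsP P))))).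
Let vertexE : points P = hull vertex :=
  svalP (cid (svalP (cid (polytopal_hull (pointsP P))))).

(** A face is determined by the rows of the vertex matrix that it contains, so
    that the faces form a finite type, and the number of these rows serves as a
    rank for inductions. *)
Definition face_code F : {set 'I_vertex_count} :=
  finset (fun i => `[< val F (row i vertex) >]).

Lemma face_code_le F G : val F `<=` val G -> face_code F \subset face_code G.
Proof.
move=> FG; apply/fintype.subsetP => i; rewrite !finset.in_set => /asboolP Fi.
by apply/asboolP; exact: FG.
Qed.

Lemma face_code_inj : injective face_code.
Proof.
move=> F G FG; apply: val_inj => /=.
have hF (H : face P) : is_face (hull vertex) (val H) by rewrite -vertexE; exact: face_isface.
rewrite (face_hull_vertices (hF F)) (face_hull_vertices (hF G)).
have FGi i : val F (row i vertex) = val G (row i vertex).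
  move/finset.setP/(_ i): FG; rewrite !finset.in_set => FGi.
  by apply/propext; split=> /asboolP H; apply/asboolP; rewrite ?FGi// -FGi.
by congr convex_hull; congr image; apply/funext => i /=; exact: FGi.
Qed.

Definition face_decode (S : {set 'I_vertex_count}) : option (face P) :=
  if pselect (exists F, face_code F = S) is left e then Some (sval (cid e))
  else None.

Lemma face_codeK : pcancel face_code face_decode.
Proof.
move=> F; rewrite /face_decode; case: pselect => [e|[]]; last by exists F.
by congr Some; apply: face_code_inj; exact: svalP (cid e).
Qed.

Definition rank F := #|face_code F|.

Lemma rank_eq F G : val F `<=` val G -> (rank G <= rank F)%N -> F = G.
Proof.
move=> FG GF; apply: face_code_inj; apply/eqP.
by rewrite eqEcard face_code_le.
Qed.

Lemma rank_lt F G : val F `<=` val G -> F <> G -> (rank F < rank G)%N.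
Proof. by move=> FG nFG; rewrite ltnNge; apply/negP => /(rank_eq FG). Qed.

(** A smallest face containing the point has it in its relative interior. *)
Lemma point_in_relint F x : val F x ->
  exists G, val G `<=` val F /\ relint (val G) x.
Proof.
have [n] := ubnP (rank F); elim: n F x => // n IH F x rF Fx.
have [rx|[G [fG Gx nFG]]] := polytopal_relint_or_face (face_polytopal F) Fx.
  by exists F; split=> // y.
pose G' := mkface (polytope_face_trans (face_isface F) fG).
have GF : val G' `<=` val F by have [_ [l [c [_ E]]]] := fG; rewrite /= E => y [].
have [H [HG Hx]] : exists H : face P, val H `<=` val G' /\ relint (val H) x.
  apply: IH => //; apply: leq_trans (rank_lt GF _) _; last by rewrite -ltnS.
  by move=> E; apply: nFG; rewrite -E.
by exists H; split=> //; exact: subset_trans HG GF.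
Qed.

Lemma relint_sub_face F G x : relint (val F) x -> val G x -> val F `<=` val G.
Proof.
by move=> rx Gx; exact: face_relint_sub (face_isface G) (@face_sub _ _ _ F) rx Gx.
Qed.

Lemma relint_face_inj F G x : relint (val F) x -> relint (val G) x -> F = G.
Proof.
move=> Fx Gx; apply: val_inj; apply/seteqP; split.
  exact: relint_sub_face Fx Gx.1.
exact: relint_sub_face Gx Fx.1.
Qed.

Lemma polytope_relint_face x : points P x -> exists F, relint (val F) x.
Proof. by move=> Px; have [F [_ ?]] := @point_in_relint (whole_face P) x Px; exists F. Qed.

End FacePoset.

(** An alias of the type of faces that carries the finite structure, whose
    equality test is not the one inherited by the ordered type. *)
Definition faces (R : realType) (P : polytope R) : Type := face P.

HB.instance Definition _ (R : realType) (P : polytope R) :=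
  Finite.copy (faces P) (pcan_type (@face_codeK R P)).

(** * Barycentric subdivision of a polytope *)

Section RayExit.
Variables (R : realType) (n : nat).
Local Notation V := 'rV[R]_n.

(** The last point of A on the ray from b through x cannot be a relative interior
    point: from there the ray could be continued inside A. *)
Lemma ray_exit (A : set V) (b x : V) : compact A -> A b -> A x -> x <> b ->
  exists s y, [/\ 0 <= s, s <= 1, A y, ~ relint A y &
    x = (1 - s) *: b + s *: y].
Proof.
move=> cA Ab Ax xb.
have [i xi] : exists i, x 0 i - b 0 i != 0.
  apply: contrapT => /forallNP H; apply: xb; apply/rowP => i; apply/eqP.
  by rewrite -subr_eq0; apply/negPn/negP => /H.
(* The position of y on the line, read off on a coordinate that varies. *)
pose f (y : V) := (y 0 i - b 0 i) * (x 0 i - b 0 i)^-1.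
have cf : continuous f.
  apply: continuous_mulr; last exact: cst_continuous.
  apply: (@continuous_addv R _ _ (fun y : V => y 0 i) (cst (- b 0 i))).
    exact: coord_continuous.
  exact: cst_continuous.
pose g (y : V) : V := y - b + f y *: (b - x).
have cg : continuous g.
  apply: continuous_addv.
    by apply: continuous_addv; [move=> y; exact: cvg_id|exact: cst_continuous].
  by apply: continuous_scaler => //; exact: cst_continuous.
pose L := A `&` g @^-1` [set 0].
have cL : compact L.
  apply: compact_closedI => //; apply: closed_preimage => //.
  apply: compact_closed; last exact: compact_set1.
  exact: norm_hausdorff.
have fx : f x = 1 by rewrite /f divff.
have Lx : L x by split=> //; rewrite /g /= fx scale1r addrC subrKA subrr.
have [y Ly ymax] := compact_EVT_max (ex_intro _ x Lx) cL (continuous_subspaceT cf).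
have [Ay gy] := set_mem Ly.
have yE : y = b + f y *: (x - b).
  move: gy; rewrite /g /= -(opprB x b) scalerN => /eqP; rewrite subr_eq0 => /eqP <-.
  by rewrite addrC subrK.
have fy1 : 1 <= f y by rewrite -fx; apply: ymax; exact: mem_set.
have fy0 : 0 < f y by apply: lt_le_trans fy1.
exists (f y)^-1, y; split.
- by rewrite invr_ge0 ltW.
- by rewrite invf_le1.
- by [].
- move=> ry.
  have [e e0 Ae] := relint_extend ry (affine_hull_sub Ax) (affine_hull_sub Ab).
  set z := y + _ in Ae.
  have fz : f z = f y + e.
    by rewrite /f /z !mxE; field.
  have Lz : L z.
    split=> //; rewrite /g /= fz {1}/z {1}yE.
    by apply/rowP => j; rewrite !mxE; ring.
  have := ymax _ (mem_set Lz); rewrite fz gerDl.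
  by rewrite leNgt e0.
- rewrite [X in _ *: b + _ *: X]yE; apply/rowP => j; rewrite !mxE; field.
  by rewrite gt_eqF.
Qed.

End RayExit.

Section Barycentric.
Variables (R : realType) (P : polytope R).
Local Notation V := 'rV[R]_(ambient_dim P).
Implicit Types (F G H : faces P) (x y z : V) (t u : faces P -> R).

Definition barycenter F : V := sval (cid (polytopal_relint_neq0 (face_polytopal F))).

Lemma barycenter_relint F : relint (val F) (barycenter F).
Proof. exact: svalP (cid (polytopal_relint_neq0 (face_polytopal F))). Qed.

Definition chain t := forall F G, t F != 0 -> t G != 0 ->
  val F `<=` val G \/ val G `<=` val F.

Definition below F t := forall G, t G != 0 -> val G `<=` val F.

Definition chain_point t x := [/\ forall F, 0 <= t F, chain t,
  \sum_F t F = 1 & \sum_F t F *: barycenter F = x].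

Lemma weighted_barycenter_in F t : (forall G, 0 <= t G) -> \sum_G t G = 1 ->
  below F t -> val F (\sum_G t G *: barycenter G).
Proof.
move=> t0 t1 tF; apply: convex_sum => //; first exact: face_is_convex.
by move=> G tG; apply: (tF _ tG); exact: (barycenter_relint G).1.
Qed.

(** Half of the weight of F is set apart: the point lies strictly between the
    barycenter of F and another point of F. *)
Lemma weighted_barycenter_relint F t : (forall G, 0 <= t G) -> \sum_G t G = 1 ->
  below F t -> t F != 0 -> relint (val F) (\sum_G t G *: barycenter G).
Proof.
move=> t0 t1 tF tFn0.
have tF0 : 0 < t F by rewrite lt_def tFn0 t0.
have tF1 : t F <= 1 by rewrite -t1 (bigD1 F)//= lerDl sumr_ge0.
pose e := t F / 2.
have e0 : 0 < e by rewrite divr_gt0.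
have e1 : 0 < 1 - e by rewrite /e; lra.
pose u G := (1 - e)^-1 * (t G - (if G == F then e else 0)).
have se : \sum_G (if G == F then e else 0) = e.
  by rewrite -big_mkcond big_pred1_eq.
have sb : \sum_G (if G == F then e else 0) *: barycenter G = e *: barycenter F.
  rewrite (bigD1 F)//= eqxx big1 ?addr0// => G /negPf ->.
  by rewrite scale0r.
have u0 G : 0 <= u G.
  rewrite mulr_ge0 ?invr_ge0 ?(ltW e1)//.
  by case: eqP => [->|_]; rewrite ?subr0//; rewrite /e; lra.
have u1 : \sum_G u G = 1.
  by rewrite -mulr_sumr sumrB t1 se mulVf// gt_eqF.
have uF : below F u.
  move=> G; rewrite /u; have [-> _//|GF] := eqVneq G F.
  rewrite subr0 mulf_eq0 negb_or => /andP[_]; exact: tF.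
have -> : \sum_G t G *: barycenter G =
    (1 - e) *: (\sum_G u G *: barycenter G) + e *: barycenter F.
  rewrite -sb scaler_sumr -big_split/=; apply: eq_bigr => G _.
  by rewrite scalerA -scalerDl /u mulrA divff ?mul1r ?subrK// gt_eqF.
apply: relint_segment => //.
- exact: face_is_convex.
- exact: weighted_barycenter_in.
- exact: barycenter_relint.
- by rewrite ltW// -subr_gt0.
Qed.

Lemma chain_top t : chain t -> \sum_G t G != 0 -> exists F, t F != 0 /\ below F t.
Proof.
move=> ct tn0.
have [F0 tF0] : exists F, t F != 0.
  apply: contrapT => /forallNP H; move/eqP: tn0; apply.
  by apply: big1 => G _; apply/eqP/negPn/negP => /H.
have := @arg_maxnP _ F0 (fun F => t F != 0) (fun F => rank F) tF0.
case=> F tF Fmax; exists F; split=> // G tG.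
have [//|FG] := ct _ _ tG tF.
by rewrite (rank_eq FG (Fmax _ tG)).
Qed.

(** After normalization, the point is in the relative interior of both top
    faces. *)
Lemma chain_top_eq t u F G : (forall H, 0 <= t H) -> (forall H, 0 <= u H) ->
  \sum_H t H = \sum_H u H ->
  \sum_H t H *: barycenter H = \sum_H u H *: barycenter H ->
  t F != 0 -> u G != 0 -> below F t -> below G u -> F = G.
Proof.
move=> t0 u0 tu tub tF uG Ft Gu.
pose c := \sum_H t H.
have c0 : c != 0.
  rewrite gt_eqF// /c (bigD1 F)//= ltr_wpDr ?sumr_ge0//.
  by rewrite lt_def tF t0.
have normalized (s : faces P -> R) H0 : (forall H, 0 <= s H) -> \sum_H s H = c ->
    s H0 != 0 -> below H0 s ->
    relint (val H0) (c^-1 *: \sum_H s H *: barycenter H).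
  move=> s0 sc sH0 Hs; have cp : 0 <= c^-1 by rewrite invr_ge0 -sc sumr_ge0.
  rewrite scaler_sumr; under eq_bigr do rewrite scalerA.
  apply: weighted_barycenter_relint.
  - by move=> H; rewrite mulr_ge0.
  - by rewrite -mulr_sumr sc mulVf.
  - by move=> H; rewrite mulf_eq0 negb_or => /andP[_]; exact: Hs.
  - by rewrite mulf_neq0 ?invr_eq0.
apply: (@relint_face_inj R P F G (c^-1 *: \sum_H t H *: barycenter H)).
  exact: normalized.
by rewrite tub; apply: normalized => //; rewrite -tu.
Qed.

(** Both families have the same top face F.  Subtract the smaller of their two
    weights at F from both.  The other one must vanish too, because the tops of
    the differences agree again, and the supports are now of smaller rank.
    Subtraction does not preserve the total weight 1, whence the general
    statement. *)
Lemma chain_weights_uniq t u : (forall H, 0 <= t H) -> (forall H, 0 <= u H) ->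
  chain t -> chain u -> \sum_H t H = \sum_H u H ->
  \sum_H t H *: barycenter H = \sum_H u H *: barycenter H -> t =1 u.
Proof.
have [n] : exists n, forall G, t G != 0 \/ u G != 0 -> (rank G < n)%N.
  exists (\max_(G : faces P) rank G).+1 => G _; rewrite ltnS.
  exact: (leq_bigmax (F := fun H : faces P => rank H) G).
elim: n t u => [|n IH] t u.
  move=> H _ _ _ _ _ _ G.
  have [//|tuG] := eqVneq (t G) (u G).
  suff /H : t G != 0 \/ u G != 0 by [].
  by have [tG|] := eqVneq (t G) 0; [right; rewrite -tG eq_sym|left].
wlog tle : t u / exists F, [/\ t F <= u F, t F != 0 & below F t].
  move=> W rtu t0 u0 ct cu tu tub.
  have [S0|Sn0] := eqVneq (\sum_H t H) 0.
    move=> G; have tG : t G = 0 by apply: (@psumr_eq0P _ _ xpredT).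
    by rewrite tG; apply/esym; apply: (@psumr_eq0P _ _ xpredT) => //; rewrite -tu.
  have [F [tF Ft]] := chain_top ct Sn0.
  have [G [uG Gu]] : exists G, u G != 0 /\ below G u.
    by apply: chain_top => //; rewrite -tu.
  have FG : F = G by exact: chain_top_eq t0 u0 tu tub tF uG Ft Gu.
  have [tuF|utF] := leP (t F) (u F).
    by apply: W => //; exists F.
  have E : u =1 t.
    apply: W => //; first by exists F; rewrite ltW// FG.
    by move=> H [h|h]; apply: rtu; [right|left].
  by move=> H; rewrite E.
move: tle => [F [tuF tF Ft]] rtu t0 u0 ct cu tu tub.
pose d G := if G == F then t F else 0.
pose t' G := t G - d G; pose u' G := u G - d G.
have dG G : G != F -> d G = 0 by rewrite /d => /negPf ->.
have d0 G : t G = 0 -> d G = 0.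
  by rewrite /d; case: eqP => // ->.
have t'F : t' F = 0 by rewrite /t' /d eqxx subrr.
have Sn0 : \sum_H t H != 0.
  rewrite gt_eqF// (bigD1 F)//= ltr_wpDr ?sumr_ge0//.
  by rewrite lt_def tF t0.
have [G [uG Gu]] : exists G, u G != 0 /\ below G u.
  by apply: chain_top => //; rewrite -tu.
have FG : F = G by exact: chain_top_eq t0 u0 tu tub tF uG Ft Gu.
rewrite -{G}FG in uG Gu.
have t't G : t' G != 0 -> t G != 0 by apply: contra => /eqP tG; rewrite /t' tG d0// subrr.
have u'u G : u' G != 0 -> u G != 0.
  have [->//|GF] := eqVneq G F.
  by rewrite /u' dG// subr0.
have t'0 G : 0 <= t' G.
  by have [->|GF] := eqVneq G F; rewrite ?t'F// /t' dG// subr0.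
have u'0 G : 0 <= u' G.
  have [->|GF] := eqVneq G F; first by rewrite /u' /d eqxx subr_ge0.
  by rewrite /u' dG// subr0.
have ct' : chain t' by move=> G H /t't tG /t't tH; exact: ct.
have cu' : chain u' by move=> G H /u'u uG' /u'u uH; exact: cu.
have tu' : \sum_H t' H = \sum_H u' H by rewrite !sumrB tu.
have tub' : \sum_H t' H *: barycenter H = \sum_H u' H *: barycenter H.
  under eq_bigr do rewrite scalerBl.
  under [RHS]eq_bigr do rewrite scalerBl.
  by rewrite !sumrB tub.
suff E : t' =1 u' by move=> H; have /addIr := E H.
have u'F : u' F = 0.
  apply/eqP/negPn/negP => u'Fn0.
  have Fu' : below F u' by move=> G /u'u/Gu.
  have Sn0' : \sum_H t' H != 0.
    rewrite tu' gt_eqF// (bigD1 F)//= ltr_wpDr ?sumr_ge0//.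
    by rewrite lt_def u'Fn0 u'0.
  have [G [tG Gt]] := chain_top ct' Sn0'.
  have GF := chain_top_eq t'0 u'0 tu' tub' tG u'Fn0 Gt Fu'.
  by move: tG; rewrite GF t'F eqxx.
apply: IH => // G H.
have GF : G <> F by move=> E; move: H; rewrite E t'F u'F eqxx => -[].
apply: leq_trans (_ : rank F <= n)%N; last first.
  by rewrite -ltnS; apply: rtu; left.
by apply: rank_lt => //; case: H => [/t't/Ft|/u'u/Gu].
Qed.

(** Project x from the barycenter of F to a point y that is not in the relative
    interior of F, and decompose y in the proper face that contains it. *)
Lemma chain_point_exists F x : val F x -> exists t, chain_point t x /\ below F t.
Proof.
have [n] := ubnP (rank F); elim: n F x => // n IH F x rF Fx.
have delta_sum (a : faces P -> R) : \sum_G (if G == F then a G else 0) = a F.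
  by rewrite -big_mkcond big_pred1_eq.
have delta_bar (a : R) :
    \sum_G (if G == F then a else 0) *: barycenter G = a *: barycenter F.
  rewrite (bigD1 F)//= eqxx big1 ?addr0// => G /negPf ->.
  by rewrite scale0r.
have [->|xb] := pselect (x = barycenter F).
  exists (fun G => if G == F then 1 else 0); split; last first.
    by move=> G; have [-> _ //|_ /eqP//] := eqVneq G F.
  split.
  - by move=> G; case: eqP.
  - move=> G H; have [-> _|_ /eqP//] := eqVneq G F.
    by have [-> _|_ /eqP//] := eqVneq H F; left.
  - exact: (delta_sum (fun=> 1)).
  - by rewrite delta_bar scale1r.
have [s [y [s0 s1 Fy ry xE]]] := ray_exit (polytopal_compact (face_polytopal F))
  (barycenter_relint F).1 Fx xb.
have [//|[G [fG Gy nFG]]] := polytopal_relint_or_face (face_polytopal F) Fy.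
pose G' : faces P := mkface (polytope_face_trans (face_isface F) fG).
have GF : val G' `<=` val F by have [_ [l [c [_ E]]]] := fG; rewrite /= E => z [].
have [t [[t0 ct t1 ty] Gt]] : exists t, chain_point t y /\ below G' t.
  apply: IH => //; apply: leq_trans (rank_lt GF _) _; last by rewrite -ltnS.
  by move=> E; apply: nFG; rewrite -E.
pose u H := (if H == F then 1 - s else 0) + s * t H.
have Fu : below F u.
  move=> H; rewrite /u; have [-> _ //|_] := eqVneq H F.
  rewrite add0r mulf_eq0 negb_or => /andP[_ /Gt HG].
  exact: subset_trans HG GF.
exists u; split=> //; split.
- move=> H; rewrite addr_ge0 ?mulr_ge0//.
  by case: eqP; rewrite ?subr_ge0.
- move=> H K; have [-> _ /Fu|HF] := eqVneq H F; first by right.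
  have [-> /Fu|KF] := eqVneq K F; first by left.
  rewrite /u (negPf HF) (negPf KF) !add0r !mulf_eq0 !negb_or.
  by move=> /andP[_ tH] /andP[_ tK]; exact: ct.
- by rewrite big_split/= (delta_sum (fun=> 1 - s)) -mulr_sumr t1; ring.
- rewrite xE -ty -delta_bar scaler_sumr -big_split/=.
  by apply: eq_bigr => H _; rewrite scalerDl scalerA.
Qed.

(** The weights of x in the barycentric subdivision, as a total function; they
    are meaningful for points of the polytope. *)
Definition bary x : faces P -> R := xget (fun=> 0) (chain_point^~ x).

Lemma baryP x : points P x -> chain_point (bary x) x.
Proof.
move=> Px; apply: (@xgetPex _ (fun=> 0) (chain_point^~ x)).
by have [t [tx _]] := @chain_point_exists (whole_face P) x Px; exists t.
Qed.

Lemma below_whole t : below (whole_face P) t.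
Proof. by move=> G _; exact: face_sub. Qed.

Lemma chain_point_in t x : chain_point t x -> points P x.
Proof.
move=> [t0 _ t1 <-]; apply: (@weighted_barycenter_in (whole_face P)) => //.
exact: below_whole.
Qed.

Lemma bary_uniq t x : chain_point t x -> bary x = t.
Proof.
move=> tx; have [t0 ct t1 tE] := tx.
have [u0 cu u1 uE] := baryP (chain_point_in tx).
apply/funext; apply: chain_weights_uniq => //; first by rewrite u1.
by rewrite uE.
Qed.

Lemma bary_ge0 x F : points P x -> 0 <= bary x F.
Proof. by move=> /baryP[]. Qed.

Lemma bary_sum x : points P x -> \sum_F bary x F = 1.
Proof. by move=> /baryP[]. Qed.

Lemma bary_chain x : points P x -> chain (bary x).
Proof. by move=> /baryP[]. Qed.

Lemma bary_barycenter x : points P x ->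
  \sum_F bary x F *: barycenter F = x.
Proof. by move=> /baryP[]. Qed.

Lemma bary_inj x y : points P x -> points P y -> bary x =1 bary y -> x = y.
Proof.
move=> Px Py xy; rewrite -(bary_barycenter Px) -(bary_barycenter Py).
by apply: eq_bigr => F _; rewrite xy.
Qed.

Lemma bary_below x F : points P x -> (val F x <-> below F (bary x)).
Proof.
move=> Px; split=> [Fx|Fx]; last first.
  rewrite -(bary_barycenter Px); apply: weighted_barycenter_in => //.
    by move=> G; exact: bary_ge0.
  exact: bary_sum.
by have [t [tx Ft]] := chain_point_exists Fx; rewrite (bary_uniq tx).
Qed.

Lemma bary_relint x F : points P x ->
  (relint (val F) x <-> val F x /\ bary x F != 0).
Proof.
move=> Px; split=> [rx|[Fx xF]]; last first.
  rewrite -(bary_barycenter Px); apply: weighted_barycenter_relint => //.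
  - by move=> G; exact: bary_ge0.
  - exact: bary_sum.
  - exact/bary_below.
split; first exact: rx.1.
have [|G [xG Gx]] := chain_top (bary_chain Px).
  by rewrite bary_sum// oner_eq0.
suff -> : F = G by [].
apply: (relint_face_inj rx); rewrite -(bary_barycenter Px).
apply: weighted_barycenter_relint => //; last exact: bary_sum.
by move=> H; exact: bary_ge0.
Qed.

Let m := #|{: faces P}|.
Let weights : set 'rV[R]_m := @simplex R m `&`
  [set v | forall F G, ~ (val F `<=` val G \/ val G `<=` val F) ->
     v 0 (enum_rank F) * v 0 (enum_rank G) = 0].
Let sum_barycenters (v : 'rV[R]_m) : V :=
  v *m (\matrix_(i < m) barycenter (enum_val i)).

Let weights_compact : compact weights.
Proof.
apply: compact_closedI; first exact: simplex_compact.
rewrite [X in closed X](_ : _ = \bigcap_(FG in [set FG : faces P * faces P |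
    ~ (val FG.1 `<=` val FG.2 \/ val FG.2 `<=` val FG.1)])
    [set v : 'rV[R]_m | v 0 (enum_rank FG.1) * v 0 (enum_rank FG.2) = 0]).
  apply: closed_bigI => -[F G] _.
  apply: (@closed_preimage _ _ (fun v : 'rV[R]_m =>
    v 0 (enum_rank F) * v 0 (enum_rank G)) [set x | x = 0]); last exact: closed_eq.
  by apply: continuous_mulr; exact: coord_continuous.
apply/seteqP; split=> v H; first by move=> [F G] /= FG; exact: H.
by move=> F G FG; exact: (H (F, G)).
Qed.

Let weights_chain v : weights v ->
  chain_point (fun F => v 0 (enum_rank F)) (sum_barycenters v).
Proof.
move=> [[v0 v1] cv]; split=> //.
- move=> F G vF vG; apply: contrapT => /cv/eqP.
  by rewrite mulf_eq0 (negPf vF) (negPf vG).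
- by rewrite -v1 (reindex (@enum_rank (faces P)))//; exact: onW_bij (enum_rank_bij _).
- rewrite /sum_barycenters mulmx_sum_row.
  rewrite [RHS](reindex (@enum_rank (faces P)))/=; last exact: onW_bij (enum_rank_bij _).
  by apply: eq_bigr => F _; rewrite rowK enum_rankK.
Qed.

Let bary_weights x : points P x ->
  exists2 v, weights v & sum_barycenters v = x /\
    forall F, v 0 (enum_rank F) = bary x F.
Proof.
move=> Px; pose v : 'rV[R]_m := \row_i bary x (enum_val i).
have vE F : v 0 (enum_rank F) = bary x F by rewrite mxE enum_rankK.
have wv : weights v.
  split; first split.
  - by move=> i; rewrite mxE bary_ge0.
  - rewrite -(bary_sum Px) (reindex (@enum_rank (faces P)))/=.
      by apply: eq_bigr => F _; rewrite vE.
    exact: onW_bij (enum_rank_bij _).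
  - move=> F G nFG; rewrite !vE; apply/eqP/negPn/negP.
    by rewrite mulf_eq0 negb_or => /andP[xF xG]; apply: nFG; exact: (bary_chain Px xF xG).
exists v => //; split=> //.
have [_ _ _ <-] := weights_chain wv.
by apply: etrans (bary_barycenter Px); apply: eq_bigr => F _; rewrite vE.
Qed.

(** The weights with chain support form a compact space, which the sum of
    barycenters maps continuously and bijectively onto the polytope; so the
    inverse image of a closed set of weights is the image of a compact set. *)
Lemma bary_continuous_face F : continuous (fun x : points P => bary (val x) F).
Proof.
apply/continuous_closedP => Z cZ.
pose K := sum_barycenters @` (weights `&` [set v | Z (v 0 (enum_rank F))]).
have cK : closed K.
  apply: compact_closed; first exact: norm_hausdorff.
  apply: continuous_compact.
    exact/continuous_subspaceT/mulmx_continuous.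
  apply: compact_closedI => //.
  apply: (@closed_preimage _ _ (fun v : 'rV[R]_m => v 0 (enum_rank F)) Z) => //.
  exact: coord_continuous.
rewrite (_ : _ @^-1` Z = (val : points P -> V) @^-1` K).
  by apply: closed_preimage => //; exact: continuous_val.
apply/seteqP; split=> x /=.
  move=> Zx; have [v wv [vx vE]] := bary_weights (set_mem (valP x)).
  by exists v => //; split=> //=; rewrite vE.
by move=> [v [wv Zv] <-]; rewrite (bary_uniq (weights_chain wv)).
Qed.

End Barycentric.

(** * Moving points along an embedding of face posets *)

Lemma continuous_bary_sum (R : realType) (Q : polytope R) (X : topologicalType)
    n (g : X -> points Q)
    (I : finType) (H : I -> faces Q) (c : I -> 'rV[R]_n) : continuous g ->
  continuous (fun x => \sum_i bary (val (g x)) (H i) *: c i).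
Proof.
move=> cg; apply: continuous_sum => i; apply: continuous_scaler.
  move=> x; apply: (@continuous_comp _ _ _ g (fun y => bary (val y) (H i))).
    exact: cg.
  exact: bary_continuous_face.
exact: cst_continuous.
Qed.

Section Transport.
Variables (R : realType) (P Q : polytope R) (s : faces P -> faces Q).

(** An isomorphism onto the poset of the faces below the image of the whole
    polytope. *)
Definition down_embedding :=
  (forall F G, val (s F) `<=` val (s G) <-> val F `<=` val G) /\
  (forall H : faces Q, val H `<=` val (s (whole_face P)) -> exists F, s F = H).

Definition transport (x : 'rV[R]_(ambient_dim P)) : 'rV[R]_(ambient_dim Q) :=
  \sum_G bary x G *: barycenter (s G).

Hypothesis se : down_embedding.

Lemma down_embedding_inj : injective s.
Proof.
move=> F G FG; apply: val_inj; apply/seteqP.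
by split; apply/se.1; rewrite FG => ?.
Qed.

Lemma down_embedding_whole G : val (s G) `<=` val (s (whole_face P)).
Proof. by apply/se.1; exact: face_sub. Qed.

(** The images of a chain of faces form a chain, so that the sum defining the
    transported point is already its barycentric decomposition. *)
Lemma bary_transport_sum x : points P x ->
  bary (transport x) = fun H => \sum_(G | s G == H) bary x G.
Proof.
move=> Px; apply: bary_uniq.
have c0 G : 0 <= bary x G by exact: bary_ge0.
have supp H : \sum_(G | s G == H) bary x G != 0 ->
    exists2 G, s G = H & bary x G != 0.
  apply: contra_neqP => /forall2NP h; rewrite big1// => G /eqP GH.
  by have [|/negP/negPn/eqP] := h G.
split.
- by move=> H; exact: sumr_ge0.
- move=> H K /supp[G <- xG] /supp[L <- xL].
  by case: (bary_chain Px xG xL) => /se.1; [left|right].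
- by rewrite -(bary_sum Px) [RHS](partition_big s xpredT).
- rewrite /transport [RHS](partition_big s xpredT)//=; apply: eq_bigr => H _.
  by rewrite scaler_suml; apply: eq_bigr => G /eqP ->.
Qed.

Lemma sum_bary_transport x (k : faces Q -> R) : points P x ->
  \sum_H bary (transport x) H * k H = \sum_G bary x G * k (s G).
Proof.
move=> Px; rewrite bary_transport_sum// [RHS](partition_big s xpredT)//=.
by apply: eq_bigr => H _; rewrite mulr_suml; apply: eq_bigr => G /eqP ->.
Qed.

Lemma bary_transport x G : points P x ->
  bary (transport x) (s G) = bary x G.
Proof.
move=> Px; rewrite bary_transport_sum// (big_pred1 G)// => H.
by rewrite (inj_eq down_embedding_inj).
Qed.

Lemma bary_transport_out x H : points P x -> ~ val H `<=` val (s (whole_face P)) ->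
  bary (transport x) H = 0.
Proof.
move=> Px nH; rewrite bary_transport_sum// big1// => G /eqP GH.
by case: nH; rewrite -GH; exact: down_embedding_whole.
Qed.

Lemma transport_in x : points P x -> val (s (whole_face P)) (transport x).
Proof.
move=> Px; apply: convex_sum.
- exact: face_is_convex.
- by move=> G; exact: bary_ge0.
- move=> G _; apply: down_embedding_whole; exact: (barycenter_relint (s G)).1.
- exact: bary_sum.
Qed.

Lemma transport_points x : points P x -> points Q (transport x).
Proof. by move=> /transport_in; exact: face_sub. Qed.

Lemma transport_face x F : points P x ->
  (val (s F) (transport x) <-> val F x).
Proof.
move=> Px; have Qx := transport_points Px.
rewrite (bary_below (s F) Qx) (bary_below F Px); split=> h G.
  by rewrite -bary_transport// => /h /se.1.
move=> xG; have [L GL] : exists L, s L = G.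
  by apply: se.2; apply: contrapT => /(bary_transport_out Px)/eqP; rewrite (negPf xG).
by rewrite -GL; apply/se.1/h; rewrite -bary_transport// GL.
Qed.

Definition transport_inv (z : 'rV[R]_(ambient_dim Q)) : 'rV[R]_(ambient_dim P) :=
  \sum_G bary z (s G) *: barycenter G.

Lemma transport_inv_chain z : val (s (whole_face P)) z ->
  chain_point (fun G => bary z (s G)) (transport_inv z).
Proof.
move=> sz; have Qz : points Q z := @face_sub _ _ _ (s (whole_face P)) z sz.
have zs := (bary_below (s (whole_face P)) Qz).1 sz.
split=> //.
- by move=> G; exact: bary_ge0.
- by move=> G H zG zH; case: (bary_chain Qz zG zH) => /se.1; [left|right].
- rewrite -(bary_sum Qz) [RHS](bigID (fun H => `[< exists G, s G = H >]))/=.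
  rewrite [X in _ = _ + X]big1 ?addr0 => [|H /asboolPn nH]; last first.
    by apply/eqP/negPn/negP => /zs/se.2.
  rewrite [RHS](reindex_onto s
    (fun H => odflt (whole_face P) [pick G | s G == H]))/=; last first.
    move=> H /asboolP[G <-].
    by case: pickP => [K /eqP//|/(_ G)]; rewrite eqxx.
  apply: eq_bigl => G; rewrite asboolT; last by exists G.
  case: pickP => [H /eqP/down_embedding_inj->|/(_ G)]; rewrite eqxx//.
Qed.

Lemma transport_inv_points z : val (s (whole_face P)) z ->
  points P (transport_inv z).
Proof. by move=> /transport_inv_chain/chain_point_in. Qed.

Lemma bary_transport_inv z G : val (s (whole_face P)) z ->
  bary (transport_inv z) G = bary z (s G).
Proof. by move=> /transport_inv_chain/bary_uniq ->. Qed.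

Lemma transportK x : points P x -> transport_inv (transport x) = x.
Proof.
move=> Px; rewrite -[RHS]bary_barycenter//; apply: eq_bigr => G _.
by rewrite bary_transport.
Qed.

Lemma transport_invK z : val (s (whole_face P)) z ->
  transport (transport_inv z) = z.
Proof.
move=> sz; have Qz : points Q z := @face_sub _ _ _ (s (whole_face P)) z sz.
have Pz := transport_inv_points sz.
apply: bary_inj => //; first exact: transport_points.
move=> H; have [Hs|nHs] := pselect (val H `<=` val (s (whole_face P))).
  by have [G <-] := se.2 _ Hs; rewrite bary_transport// bary_transport_inv.
rewrite bary_transport_out//; apply/esym/eqP/negPn/negP => zH.
exact: nHs ((bary_below _ Qz).1 sz _ zH).
Qed.

Definition transport_map (x : points P) : val (s (whole_face P)) :=
  SigSub (mem_set (transport_in (set_mem (valP x)))).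

Lemma transport_map_face F :
  [set val (transport_map x) | x in val @^-1` val F] = val (s F).
Proof.
apply/seteqP; split=> z.
  by move=> [x Fx <-]; apply/transport_face => //; exact: set_mem (valP x).
move=> sFz; have sz := down_embedding_whole sFz.
have Pz := transport_inv_points sz.
exists (SigSub (mem_set Pz)); last by rewrite /= transport_invK.
by apply/(transport_face F Pz); rewrite transport_invK.
Qed.

(** The inverse sends a point to the combination of barycenters with the same
    weights, hence is continuous too. *)
Lemma transport_homeo : polyhedral_homeomorphism transport_map.
Proof.
split; last first.
  move=> F fF; rewrite (transport_map_face (mkface fF)).
  apply: face_restrict (face_isface (s (mkface fF))) _ (@face_sub _ _ _ _).
  exact: down_embedding_whole.
split.
  apply: continuous_to_subset; apply: continuous_bary_sum => x; exact: cvg_id.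
pose toQ : val (s (whole_face P)) -> points Q := subset_incl (@face_sub _ _ _ _).
have toP (z : val (s (whole_face P))) : transport_inv (val z) \in points P.
  by apply/mem_set/transport_inv_points; exact: (set_mem (valP z)).
exists (fun z => SigSub (toP z)); split.
- apply: continuous_to_subset; apply: (@continuous_bary_sum _ _ _ _ toQ).
  by apply: continuous_to_subset; exact: continuous_val.
- move=> x; apply: val_inj; rewrite /= transportK//.
  exact: set_mem (valP x).
- move=> z; apply: val_inj; rewrite /= transport_invK//.
  exact: set_mem (valP z).
Qed.

End Transport.

(** * Morphisms of the face category *)

(** A point outside the relative interior lies on a proper face; the image of
    that face is again a face, and it would have to be all of the target. *)
Lemma polyhedral_homeo_relint (R : realType) (Q : polytope R) n
    (B : set 'rV[R]_n) (phi : Q -> B) (x : Q) :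
  polyhedral_homeomorphism phi -> relint B (val (phi x)) -> relint Q (val x).
Proof.
move=> [[_ [psi [_ phiK _]]] phiF] rx.
have Qx : points Q (val x) by exact: set_mem (valP x).
have [//|[G [fG Gx nG]]] := polytopal_relint_or_face (pointsP Q) Qx.
case: nG => y Qy.
have fim := phiF _ fG; set im := [set _ | _ in _] in fim.
have Bim : B `<=` im.
  by apply: (face_relint_sub fim _ rx); [move=> z|exists x].
have [] := Bim (val (phi (SigSub (mem_set Qy)))).
  exact: set_mem (valP (phi _)).
move=> y' Gy' /val_inj/(congr1 psi); rewrite !phiK => y'E.
by move: Gy'; rewrite y'E.
Qed.

(** The relative interior is dense: the segment from y to one of its points
    approaches y through it. *)
Lemma eq_on_relint (R : realType) (Q : polytope R) n (f g : Q -> 'rV[R]_n) :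
  continuous f -> continuous g ->
  (forall y : Q, relint Q (val y) -> f y = g y) -> forall y, f y = g y.
Proof.
move=> cf cg fg y.
pose E := (fun y => f y + -1 *: g y) @^-1` [set 0].
have EP z : E z <-> f z = g z.
  rewrite /E /= scaleN1r; split=> [/eqP|->]; last by rewrite subrr.
  by rewrite subr_eq0 => /eqP.
apply/EP; apply: contrapT => nEy.
have cE : closed E.
  apply: closed_preimage; last first.
    by apply: compact_closed; [exact: norm_hausdorff|exact: compact_set1].
  apply: continuous_addv => //; apply: continuous_scaler => //.
  exact: cst_continuous.
have [W oW WE] : open (~` E) by exact: closed_openC.
have Wy : W (val y) by have : (~` E) y by []; rewrite -WE.
have Qy : points Q (val y) by exact: set_mem (valP y).
have [r rr] := polytopal_relint_neq0 (pointsP Q).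
have : \forall e \near (0 : R), W (val y + e *: (r - val y)).
  by have := @ray_cvg R _ (val y) (r - val y); apply; exact: open_nbhs_nbhs.
move=> /nbhs_ballP[e /= e0 eW].
pose d := Num.min (e / 2) 1.
have d0 : 0 < d by rewrite lt_min divr_gt0/=.
have d1 : d <= 1 by rewrite ge_min lexx orbT.
have de : d < e by rewrite gt_min ltr_pdivrMr// ltr_pMr// ltr1n.
have rz : relint Q ((1 - d) *: val y + d *: r).
  by apply: relint_segment => //; exact: polytopal_convex (pointsP Q).
pose z : Q := SigSub (mem_set rz.1).
have /EP Ez : f z = g z by exact: fg.
have Wz : W (val z).
  rewrite (_ : val z = val y + d *: (r - val y)).
    by apply: eW; rewrite /ball/= sub0r normrN gtr0_norm.
  by apply/rowP => i; rewrite !mxE; ring.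
have : (~` E) z by rewrite -WE.
exact.
Qed.

Section FaceCategoryTheory.
Variables (R : realType) (K : polyhedral_complex R).
Local Notation P := (@cell_polytope R K).
Implicit Types a b c d : cell K.

Lemma attach_fh_fun b a (f : face_hom b a) y :
  attach K b y = attach K a (fh_fun f y).
Proof. by rewrite (fh_attach f). Qed.

Lemma fh_onto b a (f : face_hom b a) x : val (fh_face f) x ->
  exists y, val (fh_fun f y) = x.
Proof. by rewrite fh_faceE => -[y _ <-]; exists y. Qed.

Lemma fh_relint b a (f : face_hom b a) y :
  relint (val (fh_face f)) (val (fh_fun f y)) -> relint (P b) (val y).
Proof. exact: polyhedral_homeo_relint (fh_homeo f). Qed.

Lemma fh_fun_inj b a (f : face_hom b a) y z :
  val (fh_fun f y) = val (fh_fun f z) -> y = z.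
Proof.
have [[_ [g [_ fK _]]] _] := fh_homeo f.
move=> yz; have /(congr1 g) : fh_map f y = fh_map f z by exact: val_inj.
by rewrite !fK.
Qed.

Lemma fh_fun_continuous b a (f : face_hom b a) : continuous (val \o fh_fun f).
Proof.
have [[cf _] _] := fh_homeo f => x.
exact: (continuous_comp (cf x) (@continuous_val _ _ _)).
Qed.

Lemma face_hom_exists a (F : face (P a)) :
  exists b (f : face_hom b a), fh_face f = F.
Proof.
by have [b [phi [hphi aphi]]] := attach_face F; exists b, (FaceHom hphi aphi).
Qed.

Lemma attach_open_cell a (x : P a) : relint (P a) (val x) ->
  open_cell a (attach K a x).
Proof.
move=> rx; exists (SigSub (mem_set rx)) => //=.
by rewrite /on_relint /=; congr attach; exact: val_inj.
Qed.

Lemma attach_same_cell a b (x : P a) (y : P b) : relint (P a) (val x) ->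
  relint (P b) (val y) -> attach K a x = attach K b y -> a = b.
Proof.
move=> rx ry xy; apply: (@open_cells_disjoint _ K) => //.
exists (attach K a x); split; first exact: attach_open_cell.
by rewrite xy; exact: attach_open_cell.
Qed.

Lemma attach_relint_inj a (x y : P a) : relint (P a) (val x) ->
  relint (P a) (val y) -> attach K a x = attach K a y -> x = y.
Proof.
move=> rx ry xy.
have [_ [g [_ gK _]]] := @attach_relint_homeo _ K a.
pose x' : relint (P a) := SigSub (mem_set rx).
pose y' : relint (P a) := SigSub (mem_set ry).
have : x' = y'.
  rewrite -(gK x') -(gK y'); congr g; apply: val_inj.
  rewrite /= /on_relint /=.
  rewrite (_ : subset_incl _ x' = x); last exact: val_inj.
  by rewrite (_ : subset_incl _ y' = y); last exact: val_inj.
by move=> /(congr1 val) /= xyE; apply: val_inj.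
Qed.

Lemma fh_through_relint a (x : P a) : exists d (f : face_hom d a) (w : P d),
  [/\ fh_fun f w = x, relint (P d) (val w) & relint (val (fh_face f)) (val x)].
Proof.
have [F rx] := polytope_relint_face (set_mem (valP x)).
have [d [f fF]] := face_hom_exists F.
have [w wx] : exists w, val (fh_fun f w) = val x.
  by apply: fh_onto; rewrite fF; exact: rx.1.
exists d, f, w; split.
- exact: val_inj.
- by apply: (@fh_relint _ _ f); rewrite wx fF.
- by rewrite fF.
Qed.

(** An endomorphism maps the finite set of faces of the polytope injectively to
    itself, so that the whole polytope is the image of some face. *)
Lemma fh_endo_whole c (f : face_hom c c) : val (fh_face f) = points (P c).
Proof.
pose s (G : faces (P c)) : faces (P c) :=
  mkface (polytope_face_trans (face_isface (fh_face f))
    ((fh_homeo f).2 _ (face_isface G))).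
have sub G H : val (s G) `<=` val (s H) -> val G `<=` val H.
  move=> GH x Gx; have Px := face_sub Gx.
  pose x' : P c := SigSub (mem_set Px).
  have [|y Hy yx] := GH (val (fh_fun f x')); first by exists x'.
  by move: Hy; rewrite (fh_fun_inj yx).
have s_inj : injective s.
  move=> G H GH; apply: val_inj; apply/seteqP.
  by split; apply: sub; rewrite GH => ?.
have [t _ tK] := injF_bij s_inj.
apply/seteqP; split=> x; first exact: face_sub.
rewrite -[points (P c) x]/(val (whole_face (P c)) x) -(tK (whole_face (P c))).
by move=> [y _ <-]; exact: (set_mem (valP (fh_map f y))).
Qed.

(** The point z comes from a relative interior point of some cell d; since its
    image is in the open cell of c, d is c, and the morphism from d to c is an
    endomorphism, whence z is a relative interior point too. *)
Lemma attach_inj_at_relint c (y z : P c) : relint (P c) (val y) ->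
  attach K c y = attach K c z -> y = z.
Proof.
move=> ry yz; have [d [f [w [wz rw rz]]]] := fh_through_relint z.
have dc : d = c.
  apply: (attach_same_cell rw ry).
  by rewrite (attach_fh_fun f) wz.
move: f w wz rw rz; rewrite dc => f w wz rw; rewrite fh_endo_whole => rz.
exact: attach_relint_inj.
Qed.

(** On the relative interior of the source both maps are determined by their
    composites with the characteristic map of a, which agree; and the relative
    interior is dense. *)
Lemma face_hom_uniq c a (f g : face_hom c a) :
  val (fh_face f) `<=` val (fh_face g) -> f = g.
Proof.
move=> fg; apply: face_hom_eq; apply: eq_on_relint.
- exact: fh_fun_continuous.
- exact: fh_fun_continuous.
- move=> y ry; have [|z zy] := @fh_onto _ _ g (val (fh_fun f y)).
    by apply: fg; exact: set_mem (valP (fh_map f y)).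
  have yz : y = z.
    apply: attach_inj_at_relint => //.
    rewrite (attach_fh_fun f) (attach_fh_fun g); congr attach.
    exact/esym/val_inj.
  by move: zy; rewrite -yz => /esym.
Qed.

(** A relative interior point of the common face comes from relative interior
    points of both sources. *)
Lemma face_hom_same_face b c a (f : face_hom b a) (g : face_hom c a) :
  fh_face f = fh_face g -> b = c.
Proof.
move=> fg; have [x rx] := polytopal_relint_neq0 (face_polytopal (fh_face f)).
have [y yx] := fh_onto rx.1.
have [z zx] : exists z, val (fh_fun g z) = x by apply: fh_onto; rewrite -fg; exact: rx.1.
apply: (@attach_same_cell _ _ y z).
- by apply: (@fh_relint _ _ f); rewrite yx.
- by apply: (@fh_relint _ _ g); rewrite zx -fg.
- rewrite (attach_fh_fun f) (attach_fh_fun g); congr attach.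
  by apply: val_inj; rewrite yx.
Qed.

(** Polyhedral homeomorphisms are not assumed to pull faces back to faces.  Take
    x in the relative interior of the smaller face, let z be the point above it
    in the source of g, and h the morphism to b whose face carries z.  Its source
    is the cell c, and the face of the composite contains x, hence the whole face
    of f. *)
Lemma face_hom_factor c b a (f : face_hom c a) (g : face_hom b a) :
  val (fh_face f) `<=` val (fh_face g) -> exists h, fh_compose g h = f.
Proof.
move=> fg; have [x rx] := polytopal_relint_neq0 (face_polytopal (fh_face f)).
have [y yx] := fh_onto rx.1.
have [z zx] : exists z, val (fh_fun g z) = x by apply: fh_onto; apply: fg; exact: rx.1.
have [d [h [w [wz rw rz]]]] := fh_through_relint z.
have dc : d = c.
  apply: (attach_same_cell rw (y := y)).
    by apply: (@fh_relint _ _ f); rewrite yx.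
  rewrite (attach_fh_fun h) wz (attach_fh_fun f) (attach_fh_fun g); congr attach.
  by apply: val_inj; rewrite yx.
subst d; exists h; apply/esym/face_hom_uniq.
apply: (relint_sub_face rx); rewrite -zx -wz.
by exists (fh_fun h w) => //; exact: set_mem (valP (fh_map h w)).
Qed.

Lemma face_hom_mono c b a (g : face_hom b a) (h k : face_hom c b) :
  fh_compose g h = fh_compose g k -> h = k.
Proof.
move=> hk; apply: face_hom_eq => x; congr val; apply: (@fh_fun_inj _ _ g).
by have := congr1 (fun f : face_hom c a => val (fh_fun f x)) hk.
Qed.

End FaceCategoryTheory.

(** * Isomorphisms of categories *)

Section Categories.

Definition thin (D : category) := forall (x y : D) (f g : hom x y), f = g.

Definition faithful (C D : category) (F : functor C D) :=
  forall x y (f g : hom x y), fmap F f = fmap F g -> f = g.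

Definition full (C D : category) (F : functor C D) :=
  forall x y (h : hom (F x) (F y)), exists f, fmap F f = h.

Lemma functor_ext (C D : category) (o : C -> D)
    (m m' : forall x y, hom x y -> hom (o x) (o y)) p q p' q' :
  (forall x y (f : hom x y), m x y f = m' x y f) ->
  @Functor C D o m p q = @Functor C D o m' p' q'.
Proof.
move=> mm'; have mE : m = m'.
  by apply/functional_extensionality_dep => x;
    apply/functional_extensionality_dep => y; apply/funext => f.
move: p' q'; case: _ / mE => p' q'.
by rewrite (Prop_irrelevance p p') (Prop_irrelevance q q').
Qed.

Lemma thin_functor_ext (C D : category) (F G : functor C D) : thin D ->
  fobj F = fobj G -> F = G.
Proof.
case: F G => [o m p q] [o' m' p' q'] tD /= oo'.
move: m' p' q'; case: _ / oo' => m' p' q'; apply: functor_ext => x y f.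
exact: tD.
Qed.

(** Equalities of functors are awkward, as they involve transports between hom
    types; these four consequences are enough. *)
Lemma isomorphic_functor (C D : category) : isomorphic C D ->
  exists F : functor C D,
    [/\ injective F, forall y, exists x, F x = y, faithful F & full F].
Proof.
move=> [F [G [GF FG]]].
have id_faithful (E : category) (H : functor E E) : H = id_functor E -> faithful H.
  by move=> ->.
have id_full (E : category) (H : functor E E) : H = id_functor E -> full H.
  by move=> -> x y h; exists h.
exists F; split.
- move=> x y /(congr1 G) Fxy.
  have GFx z : G (F z) = z by rewrite -[LHS]/(comp_functor G F z) GF.
  by rewrite -(GFx x) Fxy GFx.
- by move=> y; exists (G y); rewrite -[LHS]/(comp_functor F G y) FG.
- move=> x y f g fg; apply: (id_faithful _ _ GF).
  by rewrite /= fg.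
- move=> x y h; have [f fh] := id_full _ _ GF x y (fmap G h).
  by exists f; apply: (id_faithful _ _ FG); rewrite /= -[in RHS]fh.
Qed.

(** Functors to a thin category are equal as soon as they agree on objects, so no
    transport is needed in this case. *)
Lemma isomorphic_poset (D : category) d (T : porderType d) :
  isomorphic D (poset_category T) <->
  exists f : D -> T, [/\ injective f, forall t, exists x, f x = t, thin D &
    forall x y, (f x <= f y)%O <-> inhabited (hom x y)].
Proof.
split=> [/isomorphic_functor[F [Fi Fs Ff Fu]]|[f [fi fs tD fle]]].
  exists F; split=> //.
    by move=> x y g h; apply: Ff; exact: bool_irrelevance.
  move=> x y; split=> [xy|[h]]; last exact: (fmap F h).
  by have [h _] := Fu x y xy.
have tT : thin (poset_category T) by move=> x y g h; exact: bool_irrelevance.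
pose g t := sval (cid (fs t)).
have gK : cancel g f by move=> t; exact: svalP (cid (fs t)).
have fK : cancel f g by move=> x; apply: fi; rewrite gK.
have gle x y : (x <= y)%O -> inhabited (hom (g x) (g y)).
  by move=> xy; apply/fle; rewrite !gK.
pose F : functor D (poset_category T) := @Functor D (poset_category T) f
  (fun x y h => (fle x y).2 (inhabits h)) (fun x => tT _ _ _ _)
  (fun x y z u v => tT _ _ _ _).
pose G : functor (poset_category T) D := @Functor (poset_category T) D g
  (fun x y xy => inhabited_witness (gle x y xy)) (fun x => tD _ _ _ _)
  (fun x y z u v => tD _ _ _ _).
exists F, G; split; apply: thin_functor_ext => //; apply/funext => x /=.
  exact: fK.
exact: gK.
Qed.

Lemma face_leE (R : realType) (P : polytope R) (F G : face P) :
  (F <= G)%O <-> val F `<=` val G.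
Proof. by rewrite -subsetEset. Qed.

(** The object u : a -> x of the slice over x is sent to the face of its image in
    the face category. *)
Lemma slice_of_face_category (R : realType) (C : category)
    (K : polyhedral_complex R) : isomorphic C (face_category K) ->
  forall x : C, exists P : polytope R,
     isomorphic (slice_category x) (poset_category (face P)).
Proof.
move=> /isomorphic_functor[F [Fi Fs Ff Fu]] x.
exists (cell_polytope (F x)); apply/isomorphic_poset.
pose f (o : slice_category x) := fh_face (fmap F (tagged o)).
exists f; split.
- move=> [a u] [b v]; rewrite /f /= => uv.
  have ab := Fi _ _ (face_hom_same_face uv); subst b.
  by congr existT; apply: Ff; apply: face_hom_uniq; rewrite uv.
- move=> G; have [b [h hG]] := face_hom_exists G.
  have [a ab] := Fs b; subst b; have [u uh] := Fu _ _ h.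
  by exists (existT _ a u); rewrite /f /= uh.
- move=> [a u] [b v] [h hu] [k ku]; apply: eq_sig_hprop => //=.
  apply: Ff; apply: (face_hom_mono (g := fmap F v)).
  have := fmap_compose F v h; have := fmap_compose F v k.
  by rewrite hu ku /= => -> ->.
- move=> [a u] [b v]; rewrite face_leE /f /=; split=> [uv|[[h /= <-]]]; last first.
    by rewrite fmap_compose; exact: fh_image_sub.
  have [h' hE] := face_hom_factor uv; have [h hh'] := Fu _ _ h'.
  split; exists h; apply: Ff; rewrite fmap_compose /= hh'.
  exact: hE.
Qed.

End Categories.

(** * The complex of an acyclic category with polytopal slices *)

Section Realization.
Variables (R : realType) (C : category) (P : C -> polytope R).
Variable slice_face : forall x : C, slice_category x -> face (P x).
Hypothesis acyclicC : acyclic C.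
Hypothesis slice_face_inj : forall x, injective (@slice_face x).
Hypothesis slice_face_surj : forall x G, exists o, @slice_face x o = G.
Hypothesis slice_thin : forall x : C, thin (slice_category x).
Hypothesis slice_face_le : forall x (o o' : slice_category x),
  (slice_face o <= slice_face o')%O <-> inhabited (hom o o').
Implicit Types a b c d x : C.

Definition hom_face a x (u : hom a x) : faces (P x) :=
  slice_face (existT (fun a => hom a x) a u : slice_category x).

Lemma hom_face_le a b x (u : hom a x) (v : hom b x) :
  val (hom_face u) `<=` val (hom_face v) <-> exists h, compose v h = u.
Proof.
rewrite -face_leE slice_face_le; split=> [[[h hE]]|[h hE]].
  by exists h.
by split; exists h.
Qed.

(** Both morphisms are morphisms of the slice category from compose v h to v. *)
Lemma compose_inj a b x (v : hom b x) (h k : hom a b) :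
  compose v h = compose v k -> h = k.
Proof.
move=> hk.
pose o : slice_category x := existT (fun a => hom a x) a (compose v h).
pose o' : slice_category x := existT (fun a => hom a x) b v.
have := @slice_thin x o o' (exist _ h erefl) (exist _ k (esym hk)).
by move=> /(congr1 sval).
Qed.

Lemma hom_face_surj x (G : faces (P x)) : exists a (u : hom a x), hom_face u = G.
Proof. by have [[a u] uG] := slice_face_surj G; exists a, u. Qed.

Lemma hom_face_inj a x (u v : hom a x) : hom_face u = hom_face v -> u = v.
Proof.
move=> uv; have [|h <-] := (hom_face_le u v).1; first by rewrite uv.
by rewrite (acyclicC.2 _ h) compose_idr.
Qed.

Lemma hom_face_ident x : hom_face (ident x) = whole_face (P x).
Proof.
apply: val_inj; apply/seteqP; split; first exact: face_sub.
have [a [u <-]] := hom_face_surj (whole_face (P x)).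
by apply/hom_face_le; exists u; rewrite compose_idl.
Qed.

Lemma no_loop a b (u : hom a b) (v : hom b a) : a = b.
Proof. by apply: (acyclicC.1 _ _ u); exists v; split; exact: acyclicC.2. Qed.

Definition face_hom_rep x (G : faces (P x)) : slice_category x :=
  sval (cid (slice_face_surj G)).

Lemma slice_face_rep x (G : faces (P x)) : slice_face (face_hom_rep G) = G.
Proof. exact: svalP (cid (slice_face_surj G)). Qed.

Lemma face_hom_repK a x (u : hom a x) :
  face_hom_rep (hom_face u) = existT (fun a => hom a x) a u.
Proof. by apply: slice_face_inj; rewrite slice_face_rep. Qed.

Definition push_face b x (h : hom b x) (G : faces (P b)) : faces (P x) :=
  hom_face (compose h (tagged (face_hom_rep G))).

Lemma push_hom_face a b x (h : hom b x) (u : hom a b) :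
  push_face h (hom_face u) = hom_face (compose h u).
Proof. by rewrite /push_face face_hom_repK. Qed.

Lemma push_whole b x (h : hom b x) : push_face h (whole_face (P b)) = hom_face h.
Proof. by rewrite -hom_face_ident push_hom_face compose_idr. Qed.

Lemma push_face_embedding b x (h : hom b x) : down_embedding (push_face h).
Proof.
split=> [G H|H]; last first.
  have [a [u <-]] := hom_face_surj H.
  rewrite push_whole => /hom_face_le[k <-]; exists (hom_face k).
  by rewrite push_hom_face.
have [a [u <-]] := hom_face_surj G; have [c [v <-]] := hom_face_surj H.
rewrite !push_hom_face !hom_face_le; split=> -[k].
  by rewrite -composeA => /compose_inj <-; exists k.
by move=> <-; exists k; rewrite composeA.
Qed.

Lemma push_face_comp a b x (h : hom b x) (k : hom a b) :
  push_face h \o push_face k = push_face (compose h k).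
Proof.
apply/funext => G; have [c [u <-]] := hom_face_surj G.
by rewrite /= !push_hom_face composeA.
Qed.

Definition push b x (h : hom b x) := transport (push_face h).

(** The chains of faces that continue a chain of shape f: the faces of g and of
    compose g f, for some g. *)
Definition chain_type a b c (f : hom b a) (G H : faces (P c)) : bool :=
  `[< exists g : hom a c, hom_face g = G /\ hom_face (compose g f) = H >].

(** At most one g has a face in the support of the weights of y: two faces with
    the same source are incomparable.  Multiplying by the weight at g makes the
    weight at compose g f continuous where g changes. *)
Definition chain_weight c (y : 'rV[R]_(ambient_dim (P c))) b a (f : hom b a) : R :=
  \sum_G bary y G * \sum_H bary y H * (chain_type f G H)%:R.

Lemma chain_type_push a b c d (f : hom b a) (h : hom c d) G H :
  chain_type f (push_face h G) (push_face h H) = chain_type f G H.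
Proof.
have hi := down_embedding_inj (push_face_embedding h).
apply/asboolP/asboolP => -[g [gG gH]]; last first.
  by exists (compose h g); rewrite -gG -gH !push_hom_face composeA.
have [|k kg] := (hom_face_le g h).1.
  by rewrite gG -(push_whole h); exact: (down_embedding_whole (push_face_embedding h)).
exists k; split; apply: hi.
  by rewrite push_hom_face kg.
by rewrite push_hom_face composeA kg.
Qed.

Lemma chain_weight_push c d (h : hom c d) y b a (f : hom b a) :
  points (P c) y -> chain_weight (push h y) f = chain_weight y f.
Proof.
move=> Py; rewrite /chain_weight /push.
rewrite (sum_bary_transport (push_face_embedding h)
  (fun G => \sum_H bary _ H * (chain_type f G H)%:R) Py).
apply: eq_bigr => G _; congr (_ * _).
rewrite (sum_bary_transport (push_face_embedding h)
  (fun H => (chain_type f _ H)%:R) Py).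
by apply: eq_bigr => H _; rewrite chain_type_push.
Qed.

(** The only endomorphism of c is the identity, whose face is the whole
    polytope. *)
Lemma chain_weight_top b c (f : hom b c) y :
  chain_weight y f = bary y (whole_face (P c)) * bary y (hom_face f).
Proof.
have typeE G H : chain_type f G H =
    (G == whole_face (P c) :> faces _) && (H == hom_face f).
  apply/asboolP/andP => [[g []]|[/eqP -> /eqP ->]].
    by rewrite (acyclicC.2 _ g) compose_idl hom_face_ident => -> ->.
  by exists (ident c); rewrite compose_idl hom_face_ident.
rewrite /chain_weight (bigD1 (whole_face (P c) : faces _))//= [X in _ + X]big1.
  rewrite addr0; congr (_ * _); rewrite (bigD1 (hom_face f))//= big1.
    by rewrite typeE !eqxx addr0 mulr1.
  by move=> H /negPf Hf; rewrite typeE Hf andbF mulr0.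
move=> G /negPf GP; rewrite big1 ?mulr0// => H _.
by rewrite typeE GP mulr0.
Qed.

Lemma chain_weight_neq0 c y b a (f : hom b a) :
  chain_weight (c := c) y f != 0 -> inhabited (hom a c).
Proof.
move=> fy; apply: contrapT => nac; move/eqP: fy; apply.
apply: big1 => G _; rewrite big1 ?mulr0// => H _.
suff -> : chain_type f G H = false by rewrite mulr0.
by apply/asboolP => -[g _]; apply: nac.
Qed.

Lemma bary_whole_relint c y : points (P c) y ->
  relint (P c) y <-> bary y (whole_face (P c)) != 0.
Proof.
move=> Py; have := bary_relint (whole_face (P c)) Py.
by move=> ->; split=> [[]|].
Qed.

(** The value at the identity of c is nonzero on the open cell of c, and a nonzero
    value at the identity of c on the cell d requires a morphism from c to d. *)
Lemma chain_weight_cell c d y z :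
  relint (P c) y -> relint (P d) z ->
  (forall b a (f : hom b a), chain_weight y f = chain_weight z f) -> c = d.
Proof.
move=> ry rz yz.
have self e w : relint (P e) w -> chain_weight w (ident e) != 0.
  move=> rw; have /(bary_whole_relint rw.1) := rw.
  by rewrite chain_weight_top hom_face_ident => ?; rewrite mulf_neq0.
have [u] : inhabited (hom c d).
  by apply: (@chain_weight_neq0 d z _ _ (ident c)); rewrite -yz self.
have [v] : inhabited (hom d c).
  by apply: (@chain_weight_neq0 c y _ _ (ident d)); rewrite yz self.
exact: no_loop u v.
Qed.

Definition weight_fun := forall b a, hom b a -> R.

Definition face_weight c (p : weight_fun) (G : faces (P c)) : R :=
  p _ c (tagged (face_hom_rep G)).

(** At a relative interior point y of the cell c, the values of the function at
    the morphisms to c are the weights of y multiplied by the weight of the whole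
    polytope; as the weights add up to 1, their sum is that factor. *)
Definition reconstruct c (p : weight_fun) : 'rV[R]_(ambient_dim (P c)) :=
  (\sum_(G : faces (P c)) face_weight p G)^-1 *:
  \sum_(G : faces (P c)) face_weight p G *: barycenter G.

Lemma face_weightE c y (G : faces (P c)) :
  face_weight (fun b a f => chain_weight y f) G =
  bary y (whole_face (P c)) * bary y G.
Proof.
rewrite /face_weight chain_weight_top; congr (_ * bary _ _).
by rewrite -[RHS]slice_face_rep; case: (face_hom_rep G).
Qed.

Lemma sum_face_weight c y : points (P c) y ->
  \sum_(G : faces (P c)) face_weight (fun b a f => chain_weight y f) G =
  bary y (whole_face (P c)).
Proof.
move=> Py; under eq_bigr do rewrite face_weightE.
by rewrite -mulr_sumr bary_sum// mulr1.
Qed.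

Lemma reconstructK c y : relint (P c) y ->
  reconstruct c (fun b a f => chain_weight y f) = y.
Proof.
move=> ry; have Py := ry.1; have w0 := (bary_whole_relint Py).1 ry.
rewrite /reconstruct sum_face_weight//; under eq_bigr do rewrite face_weightE -scalerA.
by rewrite -scaler_sumr scalerA mulVf// scale1r bary_barycenter.
Qed.

Lemma chain_weight_continuous c b a (f : hom b a) :
  continuous (fun y : P c => chain_weight (val y) f).
Proof.
apply: continuous_sumr => G; apply: continuous_mulr.
  exact: bary_continuous_face.
apply: continuous_sumr => H; apply: continuous_mulr.
  exact: bary_continuous_face.
exact: cst_continuous.
Qed.

Definition is_cell_point (p : weight_fun) :=
  exists c (y : P c), p = fun b a f => chain_weight (val y) f.

(** The points of the complex, as functions on the morphisms of C. *)
Definition realization : Type := {p : weight_fun | is_cell_point p}.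

HB.instance Definition _ := gen_eqMixin realization.
HB.instance Definition _ := gen_choiceMixin realization.

Definition cell_map c (y : P c) : realization :=
  exist _ (fun b a f => chain_weight (val y) f)
    (ex_intro _ c (ex_intro _ y erefl)).

(** The final topology for the cell maps, finer in general than that of pointwise
    convergence. *)
Definition realization_open : set_system realization :=
  [set U | forall c, open (@cell_map c @^-1` U)].

Lemma realization_openT : realization_open setT.
Proof. by move=> c; rewrite preimage_setT; exact: openT. Qed.

Lemma realization_openI : setI_closed realization_open.
Proof. by move=> U W oU oW c; rewrite preimage_setI; exact: openI. Qed.

Lemma realization_open_bigU (I : Type) (f : I -> set realization) :
  (forall i, realization_open (f i)) -> realization_open (\bigcup_i f i).
Proof.
move=> of_ c; rewrite preimage_bigcup; apply: bigcup_open => i _.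
exact: of_.
Qed.

HB.instance Definition _ := isOpenTopological.Build realization
  realization_openT realization_openI realization_open_bigU.

Lemma realization_openE (U : set realization) :
  open U <-> forall c, open (@cell_map c @^-1` U).
Proof. by []. Qed.

Lemma realization_eq (p q : realization) : sval p = sval q -> p = q.
Proof.
by case: p q => [p hp] [q hq] /= pq; subst q; congr exist; exact: Prop_irrelevance.
Qed.

Lemma realization_closedE (B : set realization) :
  closed B <-> forall c, closed (@cell_map c @^-1` B).
Proof.
rewrite -openC realization_openE; split=> cB c.
  by rewrite -openC preimage_setC; exact: cB.
by rewrite -preimage_setC openC.
Qed.

Lemma cell_map_continuous c : continuous (@cell_map c).
Proof. by apply/continuousP => U /realization_openE. Qed.

Lemma weight_continuous b a (f : hom b a) :
  continuous (fun p : realization => sval p b a f).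
Proof.
apply/continuousP => U oU; apply/realization_openE => c.
by have /continuousP := @chain_weight_continuous c b a f; exact.
Qed.

Lemma realization_hausdorff : hausdorff_space realization.
Proof.
move=> p q pq; apply: realization_eq.
apply/functional_extensionality_dep => b; apply/functional_extensionality_dep => a.
apply/funext => f; apply: (@Rhausdorff R) => A B pA qB.
have [r [rA rB]] := pq _ _ (weight_continuous pA) (weight_continuous qB).
by exists (sval r b a f).
Qed.

Lemma cell_map_push c d (h : hom c d) (y : P c) (z : P d) :
  val z = push h (val y) -> cell_map z = cell_map y.
Proof.
move=> zy; apply: realization_eq => /=.
apply/functional_extensionality_dep => b; apply/functional_extensionality_dep => a.
apply/funext => f; rewrite zy chain_weight_push//; exact: set_mem (valP y).
Qed.

Lemma cell_map_cell c d (y : P c) (z : P d) : relint (P c) (val y) ->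
  relint (P d) (val z) -> cell_map y = cell_map z -> c = d.
Proof.
move=> ry rz /(congr1 sval) /= yz; apply: (chain_weight_cell ry rz) => b a f.
exact: (congr1 (fun p : weight_fun => p b a f) yz).
Qed.

Lemma cell_map_through_relint c (y : P c) : exists d (z : P d),
  relint (P d) (val z) /\ cell_map z = cell_map y.
Proof.
have Py := set_mem (valP y).
have [G rG] := polytope_relint_face Py.
have [d [h hG]] := hom_face_surj G.
have he := push_face_embedding h.
have hy : val (push_face h (whole_face (P d))) (val y).
  by rewrite push_whole hG; exact: rG.1.
have Pz := transport_inv_points he hy.
exists d, (SigSub (mem_set Pz)); split.
  apply/(bary_whole_relint Pz); rewrite bary_transport_inv// push_whole hG.
  exact: ((bary_relint G Py).1 rG).2.
by apply/esym/(cell_map_push (h := h)); rewrite /= /push transport_invK.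
Qed.

Lemma reconstruct_continuous c (p : realization) :
  \sum_(G : faces (P c)) face_weight (sval p) G != 0 ->
  {for p, continuous (fun p : realization => reconstruct c (sval p))}.
Proof.
move=> p0.
have cs : continuous (fun p : realization =>
    \sum_(G : faces (P c)) face_weight (sval p) G).
  by apply: continuous_sumr => G; exact: weight_continuous.
have cv : continuous (fun p : realization =>
    \sum_(G : faces (P c)) face_weight (sval p) G *: barycenter G).
  apply: continuous_sum => G; apply: continuous_scaler.
    exact: weight_continuous.
  exact: cst_continuous.
have ci : {for p, continuous (fun p : realization =>
    (\sum_(G : faces (P c)) face_weight (sval p) G)^-1)}.
  exact: (continuous_comp (cs p) (inv_continuous p0)).
exact: (cvgZ ci (cv p)).
Qed.

(** The inverse on the open cell is given by the reconstruction formula. *)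
Lemma cell_map_relint_homeo c :
  homeomorphism (to_range (on_relint (@cell_map c))).
Proof.
have relintP (z : range (on_relint (@cell_map c))) :
    exists2 y : P c, relint (P c) (val y) & cell_map y = val z.
  have [y _ yz] := set_mem (valP z).
  exists (subset_incl (@relint_sub _ _ _) y) => //.
  exact: (set_mem (valP y)).
split.
  apply: continuous_to_subset => x.
  apply: (@continuous_comp _ _ _ (subset_incl (@relint_sub _ _ (P c)))).
    by apply: continuous_to_subset; exact: continuous_val.
  exact: cell_map_continuous.
have rec (z : range (on_relint (@cell_map c))) :
    reconstruct c (sval (val z)) \in relint (P c).
  by apply/mem_set; have [y ry <-] := relintP z; rewrite /= reconstructK.
exists (fun z => SigSub (rec z)); split.
- apply: continuous_to_subset => z; have [y ry yz] := relintP z.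
  have cr : {for val z, continuous (fun p : realization => reconstruct c (sval p))}.
    apply: reconstruct_continuous; rewrite -yz /= sum_face_weight; last exact: ry.1.
    exact: (bary_whole_relint ry.1).1.
  exact: (continuous_comp (@continuous_val _ _ z) cr).
- move=> y; apply: val_inj; rewrite /= reconstructK//.
  exact: (set_mem (valP y)).
- move=> z; apply: val_inj; rewrite /= /on_relint /=.
  have [y ry yz] := relintP z; apply: (etrans _ yz); congr cell_map.
  by apply: val_inj; rewrite /= -yz /= reconstructK.
Qed.

Lemma cell_map_disjoint :
  trivIset setT (fun c => range (on_relint (@cell_map c))).
Proof.
move=> c d _ _ [p [[y _ yp] [z _ zp]]].
apply: (@cell_map_cell c d (subset_incl (@relint_sub _ _ _) y)
  (subset_incl (@relint_sub _ _ _) z)).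
- exact: (set_mem (valP y)).
- exact: (set_mem (valP z)).
- exact: etrans yp (esym zp).
Qed.

Lemma cell_map_cover : \bigcup_c range (on_relint (@cell_map c)) = setT.
Proof.
apply/seteqP; split=> // -[p [c [y pE]]] _.
have [d [z [rz zy]]] := cell_map_through_relint y.
exists d => //; exists (SigSub (mem_set rz)) => //.
rewrite /on_relint /=.
transitivity (cell_map z); first by congr cell_map; exact: val_inj.
by rewrite zy; apply: realization_eq.
Qed.

Lemma cell_map_closed (B : set realization) :
  closed B <-> forall c, closed (B `&` range (@cell_map c)).
Proof.
split=> [cB c|cB].
  apply: closedI => //; apply: compact_closed; first exact: realization_hausdorff.
  apply: continuous_compact; last exact: compact_setT_val (polytopal_compact (pointsP (P c))).
  exact/continuous_subspaceT/cell_map_continuous.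
apply/realization_closedE => c.
rewrite (_ : _ @^-1` B = @cell_map c @^-1` (B `&` range (@cell_map c))).
  by apply: closed_preimage => //; exact: cell_map_continuous.
by apply/seteqP; split=> y; [move=> By; split=> //; exists y|case].
Qed.

Definition push_map b a (h : hom b a) :
  P b -> val (push_face h (whole_face (P b))) :=
  transport_map (push_face_embedding h).

Lemma push_map_attach b a (h : hom b a) :
  @cell_map b = on_face (@cell_map a) (push_face h (whole_face (P b))) \o push_map h.
Proof. by apply/funext => y; apply/esym/(cell_map_push (h := h)). Qed.

Lemma cell_map_face a (F : face (P a)) : exists b (phi : P b -> val F),
  polyhedral_homeomorphism phi /\ @cell_map b = on_face (@cell_map a) F \o phi.
Proof.
have [b [h hF]] := hom_face_surj F; rewrite -push_whole in hF.
case: _ / hF; exists b, (push_map h); split; first exact: transport_homeo.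
exact: push_map_attach.
Qed.

Definition realization_complex : polyhedral_complex R :=
  PolyhedralComplex realization_hausdorff cell_map_continuous
    cell_map_relint_homeo cell_map_disjoint cell_map_cover cell_map_closed
    cell_map_face.

Definition hom_to_face_hom b a (h : hom b a) :
    @face_hom R realization_complex b a :=
  @FaceHom R realization_complex b a (push_face h (whole_face (P b))) (push_map h)
    (transport_homeo (push_face_embedding h)) (push_map_attach h).

Lemma hom_to_face_hom_ident a :
  hom_to_face_hom (ident a) = ident (a : face_category realization_complex).
Proof. by apply: face_hom_uniq; exact: face_sub. Qed.

Lemma hom_to_face_hom_compose a b c (g : hom b c) (f : hom a b) :
  hom_to_face_hom (compose g f) =
  fh_compose (hom_to_face_hom g) (hom_to_face_hom f).
Proof.
apply: face_hom_uniq; rewrite /= /fh_image /=.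
rewrite (transport_map_face (push_face_embedding g) (push_face f (whole_face (P a)))).
by rewrite -push_face_comp.
Qed.

(** A morphism of the category and a morphism of the face category are each
    determined by their face. *)
Lemma hom_to_face_hom_inj b a : injective (@hom_to_face_hom b a).
Proof.
move=> f g /(congr1 (@fh_face _ _ _ _)) /=; rewrite !push_whole.
exact: hom_face_inj.
Qed.

Lemma hom_to_face_hom_surj b a (f : @face_hom R realization_complex b a) :
  exists h, hom_to_face_hom h = f.
Proof.
have [c [h hf]] := hom_face_surj (fh_face f); rewrite -push_whole in hf.
have cb : c = b by apply: (@face_hom_same_face _ _ _ _ _ (hom_to_face_hom h) f).
subst c; exists h; apply: face_hom_uniq.
by rewrite -hf.
Qed.

Lemma realization_isomorphic : isomorphic C (face_category realization_complex).
Proof.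
pose F : functor C (face_category realization_complex) :=
  @Functor C (face_category realization_complex) id hom_to_face_hom
    hom_to_face_hom_ident hom_to_face_hom_compose.
pose FH := @face_hom R realization_complex.
pose inv b a (f : FH b a) : hom b a :=
  sval (cid (hom_to_face_hom_surj f)).
have invK b a (f : FH b a) : hom_to_face_hom (inv b a f) = f.
  exact: svalP (cid (hom_to_face_hom_surj f)).
have inv_ident a : inv a a (@fh_ident R realization_complex a) = ident a.
  by apply: hom_to_face_hom_inj; rewrite invK hom_to_face_hom_ident.
have inv_compose a b c (g : FH b c) (f : FH a b) :
    inv a c (fh_compose g f) = compose (inv b c g) (inv a b f).
  by apply: hom_to_face_hom_inj; rewrite hom_to_face_hom_compose !invK.
pose G : functor (face_category realization_complex) C :=
  @Functor (face_category realization_complex) C id inv inv_ident inv_compose.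
exists F, G; split; apply: functor_ext => x y f.
  by apply: hom_to_face_hom_inj; rewrite /= invK.
exact: invK.
Qed.

End Realization.

Theorem theoremA15 (R : realType) (C : category) :
  acyclic C ->
  (exists K : polyhedral_complex R, isomorphic C (face_category K)) <->
  (forall x : C, exists P : polytope R,
     isomorphic (slice_category x) (poset_category (face P))).
Proof.
move=> acyclicC; split=> [[K CK]|slices]; first exact: slice_of_face_category CK.
pose P x := sval (cid (slices x)).
have face_of x : exists f : slice_category x -> face (P x),
    [/\ injective f, forall G, exists o, f o = G, thin (slice_category x) &
      forall o o', (f o <= f o')%O <-> inhabited (hom o o')].
  by apply/isomorphic_poset; exact: svalP (cid (slices x)).
pose f x := sval (cid (face_of x)).
have fP x := svalP (cid (face_of x)).
have f_inj x : injective (f x) by case: (fP x).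
have f_surj x G : exists o, f x o = G by case: (fP x).
have f_thin (x : C) : thin (slice_category x) by case: (fP x).
have f_le (x : C) (o o' : slice_category x) :
  (f x o <= f x o')%O <-> inhabited (hom o o') by case: (fP x) => _ _ _; exact.
exists (realization_complex acyclicC f_inj f_surj f_thin f_le).
exact: realization_isomorphic.
Qed.
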